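(* The algebra isomorphism $\widetilde\psi^{\mathrm{dbl}}:\widetilde{\mathbf U}\to\widetilde{\mathcal H}(Q^{\mathrm{dbl}},\mathrm{swap})$ given by $$E_i\mapsto v^{-\frac12}\mathfrak u_{\alpha_i},\quad F_i\mapsto v^{-\frac12}\mathfrak u_{\alpha_i^\diamond},\quad K_i\mapsto\mathbb K_{\alpha_i^\diamond},\quad K_i'\mapsto\mathbb K_{\alpha_i}\qquad(i\in\mathbb I)$$ is an isomorphism of Hopf algebras.
   Context: Setting. $Q$ is a Dynkin quiver (underlying graph a simply-laced Dynkin diagram, type ADE) with vertex set $\mathbb I=\{1,\dots,n\}$. $\Phi^+$ is the set of positive roots, inside the root lattice $\mathbb Z^{\mathbb I}=\bigoplus_i\mathbb Z\alpha_i$. The Euler form is $\langle x,y\rangle_Q=\sum_i x_iy_i-\sum_{(i\to j)\in Q_1}x_iy_j$, and $(x,y)_Q=\langle x,y\rangle_Q+\langle y,x\rangle_Q$; $c_{ij}=(\alpha_i,\alpha_j)_Q$ is the Cartan matrix. For a finite field $\mathbb F_q$ and $\beta\in\Phi^+$, $M_q(\beta)$ is the indecomposable representation of $Q$ over $\mathbb F_q$ of dimension vector $\beta$. $\mathfrak P$ is the set of functions $\lambda:\Phi^+\to\mathbb N$; $M_q(\lambda)=\bigoplus_\beta M_q(\beta)^{\oplus\lambda(\beta)}$, with dimension vector $d^\lambda$; a root is identified with its characteristic function. An element $\lambda\in\mathfrak P$ appearing in a bilinear form, in a sum with elements of $\mathbb Z^{\mathbb I}$, or in a subscript of $\mathbb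 K$ stands for $d^\lambda$. Quantum group. $\widetilde{\mathbf U}$ is the $\mathbb Q(v^{1/2})$-algebra generated by $E_i,F_i,K_i^{\pm1},K_i'^{\pm1}$ ($i\in\mathbb I$) subject to: $[E_i,F_j]=\delta_{ij}(v^{-1}-v)(K_i-K_i')$; all $K_i,K_j'$ commute; $K_iE_j=v^{c_{ij}}E_jK_i$, $K_iF_j=v^{-c_{ij}}F_jK_i$, $K_i'E_j=v^{-c_{ij}}E_jK_i'$, $K_i'F_j=v^{c_{ij}}F_jK_i'$; and for $i\ne j$ the quantum Serre relations $\sum_{r=0}^{1-c_{ij}}(-1)^r\begin{bmatrix}1-c_{ij}\\ r\end{bmatrix}_vX_i^rX_jX_i^{1-c_{ij}-r}=0$ for $X=E$ and $X=F$. It is a Hopf algebra with $\Delta(E_i)=E_i\otimes1+K_i\otimes E_i$, $\Delta(F_i)=1\otimes F_i+F_i\otimes K_i'$, $\Delta(K_i)=K_i\otimes K_i$, $\Delta(K_i')=K_i'\otimes K_i'$, $\varepsilon(E_i)=\varepsilon(F_i)=0$, $\varepsilon(K_i)=\varepsilon(K_i')=1$, $S(E_i)=-K_i^{-1}E_i$, $S(F_i)=-F_iK_i'^{-1}$, $S(K_i)=K_i^{-1}$, $S(K_i')=K_i'^{-1}$. Hall polynomials. For modules $X,Y,Z$, $F_{XZ}^Y$ is the number of submodules $L\subseteq Y$ with $L\cong Z$, $Y/L\cong X$; $G_{XZ}^Y=|\mathrm{Ext}^1(X,Z)_Y|/|\mathrm{Hom}(X,Z)|$, where $\mathrm{Ext}^1(X,Z)_Y$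 is the set of extension classes with middle term isomorphic to $Y$; $a_X=|\mathrm{Aut}(X)|$. There are $f_{\lambda,\mu}^{\nu}(v),g_{\lambda,\mu}^{\nu}(v),a_\lambda(v)\in\mathbb Z[v,v^{-1}]$ whose values at $v=\sqrt q$ are $F_{M_q(\lambda),M_q(\mu)}^{M_q(\nu)}$, $G_{M_q(\lambda),M_q(\mu)}^{M_q(\nu)}$, $a_{M_q(\lambda)}$ for every $q$. Also $f^\lambda_{\lambda_1,\lambda_2,\lambda_3}=\sum_{\mu}f^\lambda_{\lambda_1,\mu}f^\mu_{\lambda_2,\lambda_3}$. Generic iHall algebra. For a quiver $Q$ that is a (possibly disconnected) union of ADE Dynkin quivers with involution $\varrho$ (acting on roots, on $\mathbb Z^{\mathbb I}$, and on $\mathfrak P$ by $(\varrho\lambda)(\beta)=\lambda(\varrho\beta)$), $\widetilde{\mathcal H}(Q,\varrho)$ is the associative unital $\mathbb Q(v^{1/2})$-algebra with basis $\{\mathbb K_\alpha*\mathfrak u_\lambda\mid\alpha\in\mathbb Z^{\mathbb I},\lambda\in\mathfrak P\}$ and multiplication determined by $\mathbb K_0=\mathfrak u_0=1$, $\mathbb K_\alpha*\mathbb K_\beta=\mathbb K_{\alpha+\beta}$, $\mathbb K_\alpha*\mathfrak u_\lambda=v^{(\varrho\alpha,\lambda)_Q-(\alpha,\lambda)_Q}\mathfrak u_\lambda*\mathbb K_\alpha$, and $$\mathfrak u_\lambda*\mathfrak u_\mu=\sum_{\theta,\nu,\gamma,\delta\in\mathfrak P}v^{\langle\delta,\theta\rangle_Q-\langle\varrho\delta,\theta\rangle_Q-\langle\lambda,\mu\rangle_Q+2\langle\nu,\gamma\rangle_Q}a_\delta(v)f^\lambda_{\delta,\nu}(v)f^\mu_{\gamma,\varrho\delta}(v)g^\theta_{\nu,\gamma}(v)\,\mathbb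 K_\delta*\mathfrak u_\theta.$$ Diagonal type. $Q^{\mathrm{dbl}}=Q\sqcup Q^\diamond$, where $Q^\diamond$ is a copy of $Q$ with vertices $i^\diamond$, and $\mathrm{swap}$ exchanges $i$ and $i^\diamond$. For $\lambda,\mu\in\mathfrak P=\mathfrak P(Q)$, $\mathfrak u_\lambda\oplus\mathfrak u_{\mu^\diamond}\in\widetilde{\mathcal H}(Q^{\mathrm{dbl}},\mathrm{swap})$ is the basis element corresponding to $M_q(\lambda)\oplus M_q(\mu)^\diamond$; $\mathfrak u_\lambda=\mathfrak u_\lambda\oplus\mathfrak u_{0}$, $\mathfrak u_{\mu^\diamond}=\mathfrak u_0\oplus\mathfrak u_{\mu^\diamond}$; for $\alpha,\beta\in\mathbb Z^{\mathbb I}$, $\mathbb K_\alpha$ and $\mathbb K_{\beta^\diamond}$ are the elements attached to the root lattices of $Q$ and $Q^\diamond$. That $\widetilde\psi^{\mathrm{dbl}}$ is an algebra isomorphism is known (Bridgeland). Hopf structure on $\widetilde{\mathcal H}(Q^{\mathrm{dbl}},\mathrm{swap})$. It is the Hopf algebra whose coproduct is the algebra homomorphism with $\mathbb K_\alpha,\mathbb K_{\alpha^\diamond}$ group-like and $$\Delta(\mathfrak u_\lambda\oplus\mathfrak u_{\mu^\diamond})=\sum_{\lambda_1,\lambda_2,\mu_1,\mu_2,\nu\in\mathfrak P}v^{\langle\lambda_1,\lambda_2+\nu\rangle_Q+\langle\mu_1,\mu_2+\nu\rangle_Q-\langle\lambda_2+\mu_2,\nu\rangle_Q-(\lambda_2,\mu_2)_Q}a_\nu(v)f^\lambda_{\lambda_1,\nu,\lambda_2}(v)f^\mu_{\mu_1,\nu,\mu_2}(v)\big((\mathfrak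 u_{\lambda_1}\oplus\mathfrak u_{\mu_2^\diamond})*\mathbb K_{\lambda_2^\diamond+\nu^\diamond}\big)\otimes\big((\mathfrak u_{\lambda_2}\oplus\mathfrak u_{\mu_1^\diamond})*\mathbb K_{\mu_2+\nu}\big);$$ the counit and antipode are uniquely determined by this bialgebra structure. *)

(* Defs.v *)
Set Warnings "-all".
From HB Require Import structures.
From mathcomp Require Import all_boot all_order all_algebra all_field.
From mathcomp Require Import finmap boolp classical_sets cardinality fsbigop.
From mathcomp Require Import monalg.

Set Implicit Arguments.
Unset Strict Implicit.
Unset Printing Implicit Defensive.

Import Order.TTheory GRing.Theory Num.Theory.
Local Open Scope ring_scope.
Local Open Scope quotient_scope.

Section Span.
Variables (K : fieldType) (V : lmodType K) (R : V -> Prop).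

Inductive lspan : V -> Prop :=
| lspan0 : lspan 0
| lspanP c r x : R r -> lspan x -> lspan (c *: r + x).

Lemma lspan_gen r : R r -> lspan r.
Proof. by move=> Rr; rewrite -[r]addr0 -[r]scale1r; apply: lspanP => //; exact: lspan0. Qed.

Lemma lspanD x y : lspan x -> lspan y -> lspan (x + y).
Proof.
by move=> Sx Sy; elim: Sx => [|c r z Rr _ IH]; rewrite ?add0r // -addrA; apply: lspanP.
Qed.

Lemma lspanZ c x : lspan x -> lspan (c *: x).
Proof.
elim=> [|d r z Rr _ IH]; first by rewrite scaler0; exact: lspan0.
by rewrite scalerDr scalerA; apply: lspanP.
Qed.

Definition lspan_pred : {pred V} := fun x => `[< lspan x >].

Fact lspan_zmod_closed : zmod_closed lspan_pred.
Proof.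
split=> [|x y /asboolP Sx /asboolP Sy]; first exact/asboolP/lspan0.
by apply/asboolP; rewrite -scaleN1r; apply: lspanD => //; apply: lspanZ.
Qed.
HB.instance Definition _ := GRing.isZmodClosed.Build V lspan_pred lspan_zmod_closed.

Definition lquot := Quotient.quot lspan_pred.
HB.instance Definition _ := GRing.Zmodule.on lquot.
Definition lquot_pi : V -> lquot := \pi_lquot.

Lemma lquot_piE x y : lspan (x - y) <-> lquot_pi x = lquot_pi y.
Proof.
rewrite /lquot_pi; split=> [S|/eqP].
  by apply/eqP; rewrite -Quotient.idealrBE; apply/asboolP.
by rewrite -Quotient.idealrBE => /asboolP.
Qed.

Lemma lquot_pi_repr (x : lquot) : lquot_pi (repr x) = x. Proof. exact: reprK. Qed.

Definition lquot_scale (c : K) (x : lquot) : lquot := lquot_pi (c *: repr x).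

Fact lquot_piD : {morph lquot_pi : x y / x + y}.
Proof. by move=> x y; rewrite /lquot_pi !piE. Qed.

Fact lquot_piZ_subproof c x : lquot_scale c (lquot_pi x) = lquot_pi (c *: x).
Proof.
apply/lquot_piE; rewrite -scalerBr; apply: lspanZ; apply/lquot_piE.
exact: lquot_pi_repr.
Qed.

Fact lquot_scaleA a b x : lquot_scale a (lquot_scale b x) = lquot_scale (a * b) x.
Proof. by rewrite -(lquot_pi_repr x) !lquot_piZ_subproof scalerA. Qed.
Fact lquot_scale1 : left_id 1 lquot_scale.
Proof. by move=> x; rewrite -(lquot_pi_repr x) lquot_piZ_subproof scale1r. Qed.
Fact lquot_scaleDr : right_distributive lquot_scale +%R.
Proof.
move=> c x y; rewrite -(lquot_pi_repr x) -(lquot_pi_repr y).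
by rewrite -lquot_piD !lquot_piZ_subproof scalerDr lquot_piD.
Qed.
Fact lquot_scaleDl x : {morph lquot_scale^~ x : a b / a + b}.
Proof.
move=> a b; rewrite -(lquot_pi_repr x) !lquot_piZ_subproof scalerDl.
by rewrite lquot_piD.
Qed.
HB.instance Definition _ := GRing.Zmodule_isLmodule.Build K lquot
  lquot_scaleA lquot_scale1 lquot_scaleDr lquot_scaleDl.

Fact lquot_pi_linear : linear lquot_pi.
Proof. by move=> c x y; rewrite lquot_piD -lquot_piZ_subproof. Qed.
HB.instance Definition _ := GRing.isLinear.Build K V lquot *:%R lquot_pi lquot_pi_linear.

End Span.

Lemma lquot_ind (K : fieldType) (V : lmodType K) (R : V -> Prop)
  (P : lquot R -> Prop) : (forall x, P (lquot_pi R x)) -> forall x, P x.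
Proof. by move=> HP x; rewrite -(lquot_pi_repr x). Qed.

Lemma linear_comb (K : fieldType) (U V : lmodType K) (c : K) (f g : U -> V) :
  linear f -> linear g -> linear (fun x => c *: f x + g x).
Proof.
move=> lf lg d x y; rewrite lf lg !scalerDr !scalerA [d * c]mulrC.
exact: addrACA.
Qed.

Section Tensor.
Variables (K : fieldType) (A B : lmodType K).

(* The tensor product over K: the free module on A * B modulo bilinearity. *)
Inductive tens_rel : {malg K[(A * B)%type]} -> Prop :=
| tens_rell c a a' b :
    tens_rel (<< (c *: a + a', b) >> - (c *: << (a, b) >> + << (a', b) >>))
| tens_relr c a b b' :
    tens_rel (<< (a, c *: b + b') >> - (c *: << (a, b) >> + << (a, b') >>)).

Definition tens := lquot tens_rel.
HB.instance Definition _ := GRing.Lmodule.on tens.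

Definition tpure (a : A) (b : B) : tens := lquot_pi tens_rel << (a, b) >>.

Definition bilin (M : lmodType K) (f : A -> B -> M) : Prop :=
  (forall b, linear (f^~ b)) /\ (forall a, linear (f a)).

Lemma tpure_bilin : bilin tpure.
Proof.
split=> [b c a a'|a c b b'] /=; rewrite /tpure -linearP; apply/lquot_piE/lspan_gen.
  exact: tens_rell.
exact: tens_relr.
Qed.

Section Lift.
Variables (M : lmodType K) (f : A -> B -> M).

Definition tlift0 (g : {malg K[(A * B)%type]}) : M :=
  \sum_(p <- msupp g) g@_p *: f p.1 p.2.

Lemma tlift0w (E : {fset (A * B)%type}) g : (msupp g `<=` E)%fset ->
  tlift0 g = \sum_(p <- E) g@_p *: f p.1 p.2.
Proof.
move=> sE; rewrite /tlift0 (big_fset_incl _ sE) // => p _ /mcoeff_outdom ->.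
by rewrite scale0r.
Qed.

Lemma tlift0_linear : linear tlift0.
Proof.
move=> c x y; pose E := (msupp x `|` msupp y `|` msupp (c *: x + y))%fset.
have sx : (msupp x `<=` E)%fset by rewrite /E -fsetUA fsubsetUl.
have sy : (msupp y `<=` E)%fset by rewrite /E fsetUAC fsubsetUr.
have sz : (msupp (c *: x + y) `<=` E)%fset by rewrite /E fsubsetUr.
rewrite (tlift0w sx) (tlift0w sy) (tlift0w sz) scaler_sumr -big_split /=.
by apply: eq_bigr => p _; rewrite mcoeffD mcoeffZ scalerDl scalerA.
Qed.

Lemma tlift0U p : tlift0 << p >> = f p.1 p.2.
Proof. by rewrite /tlift0 msuppU oner_eq0 big_seq_fset1 mcoeffUU scale1r. Qed.

Definition tlift (x : tens) : M := tlift0 (repr x).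

Hypothesis fB : bilin f.

Lemma tlift0_span x : lspan tens_rel x -> tlift0 x = 0.
Proof.
pose F : {linear {malg K[(A * B)%type]} -> M} :=
  HB.pack tlift0 (GRing.isLinear.Build _ _ _ _ tlift0 tlift0_linear).
rewrite -[tlift0]/(F : _ -> _).
elim=> [|c r z Rr _ IH]; first by rewrite linear0.
rewrite linearP IH addr0; case: Rr => [d a a' b|d a b b'].
  by rewrite linearB linearP /= !tlift0U /= fB.1 subrr scaler0.
by rewrite linearB linearP /= !tlift0U /= fB.2 subrr scaler0.
Qed.

Lemma tlift_pi x : tlift (lquot_pi tens_rel x) = tlift0 x.
Proof.
pose F : {linear {malg K[(A * B)%type]} -> M} :=
  HB.pack tlift0 (GRing.isLinear.Build _ _ _ _ tlift0 tlift0_linear).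
apply/eqP; rewrite -subr_eq0 /tlift -[tlift0]/(F : _ -> _) -linearB.
by apply/eqP/tlift0_span/lquot_piE; rewrite lquot_pi_repr.
Qed.

Lemma tlift_linear : linear tlift.
Proof.
move=> c; elim/lquot_ind=> x; elim/lquot_ind=> y.
by rewrite -linearP !tlift_pi tlift0_linear.
Qed.

Lemma tlift_pure a b : tlift (tpure a b) = f a b.
Proof. by rewrite tlift_pi tlift0U. Qed.

End Lift.

Lemma tens_ind (P : tens -> Prop) : P 0 ->
  (forall c a b x, P x -> P (c *: tpure a b + x)) -> forall x, P x.
Proof.
move=> P0 PD; elim/lquot_ind=> x; rewrite [x]monalgE.
elim: (msupp x : seq _) => [|[a b] s IH]; first by rewrite big_nil linear0.
rewrite big_cons -[x@_(a, b)]mulr1 -[<< _ *g _ >>]/(<< _ *g (a, b) >>).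
have -> : << x@_(a, b) * 1 *g (a, b) >> = x@_(a, b) *: << (a, b) >>
  :> {malg K[(A * B)%type]}.
  by apply/malgP=> k; rewrite mcoeffZ !mcoeffU mulrnAr.
by rewrite linearP; apply: PD.
Qed.

Lemma tens_linear_ext (M : lmodType K) (f g : tens -> M) :
  linear f -> linear g -> (forall a b, f (tpure a b) = g (tpure a b)) -> f =1 g.
Proof.
move=> lf lg fg.
pose F : {linear tens -> M} := HB.pack f (GRing.isLinear.Build _ _ _ _ f lf).
pose G : {linear tens -> M} := HB.pack g (GRing.isLinear.Build _ _ _ _ g lg).
move=> x; rewrite -[f x]/(F x) -[g x]/(G x); elim/tens_ind: x.
  by rewrite !linear0.
by move=> c a b x IH; rewrite !linearP IH /= fg.
Qed.

End Tensor.

Section TensorMap.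
Variables (K : fieldType) (A B A' B' : lmodType K).

Definition tmap (f : A -> A') (g : B -> B') : tens A B -> tens A' B' :=
  tlift (fun a b => tpure (f a) (g b)).

End TensorMap.

Section TensorAlgebra.
Variables (K : fieldType) (A B : algType K).
Local Notation T := (tens A B).

Definition tmul (x y : T) : T :=
  tlift (fun a b => tlift (fun a' b' => tpure (a * a') (b * b')) y) x.

Lemma tmul_bilin2 a b : bilin (fun (a' : A) (b' : B) => tpure (a * a') (b * b') : T).
Proof.
split=> [b' c x y|a' c x y] /=.
  by rewrite mulrDr -scalerAr (tpure_bilin A B).1.
by rewrite mulrDr -scalerAr (tpure_bilin A B).2.
Qed.

Lemma tmul_bilin1 y :
  bilin (fun (a : A) (b : B) => tlift (fun a' b' => tpure (a * a') (b * b')) y : T).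
Proof.
have lin a b := tlift_linear (tmul_bilin2 a b).
split=> [b c a a'|a c b b'] /=; move: y.
  apply: tens_linear_ext (lin _ _) (linear_comb c (lin a b) (lin a' b)) _ => u w.
  rewrite !(tlift_pure (tmul_bilin2 _ _)) mulrDl -scalerAl.
  exact: (tpure_bilin A B).1.
apply: tens_linear_ext (lin _ _) (linear_comb c (lin a b) (lin a b')) _ => u w.
rewrite !(tlift_pure (tmul_bilin2 _ _)) mulrDl -scalerAl.
exact: (tpure_bilin A B).2.
Qed.

Lemma tmul_linearl y : linear (tmul^~ y).
Proof. exact/tlift_linear/tmul_bilin1. Qed.

Lemma tmul_purel a b y :
  tmul (tpure a b) y = tlift (fun a' b' => tpure (a * a') (b * b')) y.
Proof. exact: (tlift_pure (tmul_bilin1 y)). Qed.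

Lemma tmul_pure a b a' b' : tmul (tpure a b) (tpure a' b') = tpure (a * a') (b * b').
Proof. by rewrite tmul_purel; exact: (tlift_pure (tmul_bilin2 a b)). Qed.

Lemma tmul_linearr x : linear (tmul x).
Proof.
move=> c y z; move: x.
apply: tens_linear_ext (tmul_linearl _)
  (linear_comb c (tmul_linearl y) (tmul_linearl z)) _ => a b.
rewrite (tmul_purel a b (c *: y + z)) (tmul_purel a b y) (tmul_purel a b z).
exact: (tlift_linear (tmul_bilin2 a b)).
Qed.

Fact tmulDl : left_distributive tmul +%R.
Proof. by move=> x y z; have := tmul_linearl z 1 x y; rewrite !scale1r. Qed.
Fact tmulDr : right_distributive tmul +%R.
Proof. by move=> x y z; have := tmul_linearr x 1 y z; rewrite !scale1r. Qed.
Fact tmul1l : left_id (tpure 1 1 : T) tmul.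
Proof.
apply: (tens_linear_ext (g := id)) (tmul_linearr _) _ _ => // a b.
by rewrite tmul_pure !mul1r.
Qed.
Fact tmul1r : right_id (tpure 1 1 : T) tmul.
Proof.
apply: (tens_linear_ext (g := id)) (tmul_linearl _) _ _ => // a b.
by rewrite tmul_pure !mulr1.
Qed.
Fact tmulA : associative tmul.
Proof.
move=> x y z; move: x.
apply: (tens_linear_ext (g := fun x => tmul (tmul x y) z)) (tmul_linearl _) _ _.
  by move=> c u w; rewrite (tmul_linearl y c u w); exact: tmul_linearl.
move=> a b; move: y; set t := tpure a b.
apply: (tens_linear_ext (f := fun y => tmul t (tmul y z))
    (g := fun y => tmul (tmul t y) z)) => [c u w|c u w|a' b'].
- by rewrite (tmul_linearl z c u w); exact: tmul_linearr.
- by rewrite (tmul_linearr t c u w); exact: tmul_linearl.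
move: z; set t' := tpure a' b'.
apply: (tens_linear_ext (f := fun z => tmul t (tmul t' z))
    (g := tmul (tmul t t'))) => [c u w||a'' b''].
- by rewrite (tmul_linearr t' c u w); exact: tmul_linearr.
- exact: tmul_linearr.
by rewrite !tmul_pure !mulrA.
Qed.

HB.instance Definition _ := GRing.Zmodule_isPzRing.Build T
  tmulA tmul1l tmul1r tmulDl tmulDr.

Lemma tpureM a b a' b' : tpure a b * tpure a' b' = tpure (a * a') (b * b') :> T.
Proof. exact: tmul_pure. Qed.

End TensorAlgebra.
Section AlgebraQuotient.
Variables (K : fieldType) (A : algType K).
Variable R : A -> Prop.

Inductive twosided : A -> Prop :=
| Twosided a r b : R r -> twosided (a * r * b).

Definition aquot := lquot twosided.
HB.instance Definition _ := GRing.Lmodule.on aquot.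

Definition aquot_pi : A -> aquot := lquot_pi twosided.
HB.instance Definition _ := GRing.Linear.on aquot_pi.
Local Notation pi := aquot_pi.

Lemma aquot_ind (P : aquot -> Prop) : (forall x, P (pi x)) -> forall x, P x.
Proof. exact: lquot_ind. Qed.

Lemma ideal_mull a x : lspan twosided x -> lspan twosided (a * x).
Proof.
elim=> [|c _ z [u r b Rr] _ IH]; first by rewrite mulr0; exact: lspan0.
rewrite mulrDr -scalerAr !mulrA; apply: lspanP => //; exact: Twosided.
Qed.

Lemma ideal_mulr a x : lspan twosided x -> lspan twosided (x * a).
Proof.
elim=> [|c _ z [u r b Rr] _ IH]; first by rewrite mul0r; exact: lspan0.
rewrite mulrDl -scalerAl -[_ * b * a]mulrA; apply: lspanP => //; exact: Twosided.
Qed.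

Definition aquot_mul (x y : aquot) : aquot := pi (repr x * repr y).

Lemma aquot_mul_pi x y : aquot_mul (pi x) (pi y) = pi (x * y).
Proof.
apply/lquot_piE; set x' := repr _; set y' := repr _.
rewrite -[x' * y'](subrK (x * y')) -mulrBl -addrA -mulrBr.
apply: lspanD; first by apply/ideal_mulr/lquot_piE; rewrite lquot_pi_repr.
by apply/ideal_mull/lquot_piE; rewrite lquot_pi_repr.
Qed.

Fact aquot_mulA : associative aquot_mul.
Proof.
by elim/aquot_ind=> x; elim/aquot_ind=> y; elim/aquot_ind=> z; rewrite !aquot_mul_pi mulrA.
Qed.
Fact aquot_mul1 : left_id (pi 1) aquot_mul.
Proof. by elim/aquot_ind=> x; rewrite aquot_mul_pi mul1r. Qed.
Fact aquot_1mul : right_id (pi 1) aquot_mul.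
Proof. by elim/aquot_ind=> x; rewrite aquot_mul_pi mulr1. Qed.
Fact aquot_mulDl : left_distributive aquot_mul +%R.
Proof.
elim/aquot_ind=> x; elim/aquot_ind=> y; elim/aquot_ind=> z.
by rewrite -linearD !aquot_mul_pi mulrDl linearD.
Qed.
Fact aquot_mulDr : right_distributive aquot_mul +%R.
Proof.
elim/aquot_ind=> x; elim/aquot_ind=> y; elim/aquot_ind=> z.
by rewrite -linearD !aquot_mul_pi mulrDr linearD.
Qed.
HB.instance Definition _ := GRing.Zmodule_isPzRing.Build aquot
  aquot_mulA aquot_mul1 aquot_1mul aquot_mulDl aquot_mulDr.

Lemma aquot_piM x y : pi x * pi y = pi (x * y).
Proof. exact: aquot_mul_pi. Qed.

Fact aquot_scaleAl (c : K) (x y : aquot) : c *: (x * y) = (c *: x) * y.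
Proof.
elim/aquot_ind: x => x; elim/aquot_ind: y => y.
by rewrite aquot_piM -!linearZ aquot_piM scalerAl.
Qed.
Fact aquot_scaleAr (c : K) (x y : aquot) : c *: (x * y) = x * (c *: y).
Proof.
elim/aquot_ind: x => x; elim/aquot_ind: y => y.
by rewrite aquot_piM -!linearZ aquot_piM scalerAr.
Qed.

End AlgebraQuotient.

Section Presentation.
Variables (K : fieldType) (X : choiceType).

Definition freealg := {malg K[{fmonom X}]}.
HB.instance Definition _ := GRing.Lalgebra.on freealg.

Fact freealg_scaleAr (c : K) (x y : freealg) : c *: (x * y) = x * (c *: y).
Proof.
have ZC (z : freealg) : c *: z = z * (c%:MP : freealg).
  rewrite malgM_def fgmulgU malgZ_def; apply: eq_bigr => k _.
  by rewrite mulm1 mulrC.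
by rewrite !ZC mulrA.
Qed.
HB.instance Definition _ :=
  GRing.Lalgebra_isAlgebra.Build K freealg freealg_scaleAr.

Definition fgen (x : X) : freealg := << fmu x >>.

Variable R : freealg -> Prop.

Section Augmentation.
Variable e : X -> K.

Definition word_aug (w : {fmonom X}) : K := \prod_(x <- (w : seq X)) e x.

Fact word_aug_mmorph : mmorphism word_aug.
Proof.
split=> [x y|]; rewrite /word_aug; first by rewrite fmM big_cat.
by rewrite fm1 big_nil.
Qed.
HB.instance Definition _ := isMultiplicative.Build _ _ word_aug word_aug_mmorph.

Definition aug : freealg -> K := mmap idfun word_aug.
HB.instance Definition _ := GRing.RMorphism.on aug.

Lemma augZ c x : aug (c *: x) = c * aug x.
Proof. by rewrite /aug mmapZ. Qed.

Lemma augM x y : aug (x * y) = aug x * aug y.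
Proof. exact: (rmorphM aug). Qed.

Lemma aug_gen x : aug (fgen x) = e x.
Proof. by rewrite /aug mmapU /= mul1r /word_aug fmU big_seq1. Qed.

Lemma aquot_nontrivial : (forall r, R r -> aug r = 0) -> (1 : aquot R) != 0.
Proof.
move=> R0; apply/eqP; rewrite -[1]/(aquot_pi R 1) -(linear0 (aquot_pi R)).
move=> /lquot_piE; rewrite subr0 => S1.
have: aug 1 = 0.
  elim: S1 => [|c _ x [u r b Rr] _ IH]; first exact: rmorph0.
  rewrite rmorphD /= [X in _ + X]IH addr0 augZ !augM (R0 _ Rr).
  by rewrite mulr0 mul0r mulr0.
by rewrite rmorph1 => /eqP; rewrite oner_eq0.
Qed.
End Augmentation.

End Presentation.

Definition tassoc (K : fieldType) (A B C : lmodType K) :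
    tens (tens A B) C -> tens A (tens B C) :=
  tlift (fun ab c => tlift (fun a b => tpure a (tpure b c)) ab).

Record hopf (K : fieldType) (A : algType K) := Hopf {
  comul : A -> tens A A;
  counit : A -> K;
  antipode : A -> A;
  comul_linear : linear comul;
  comul_morph : monoid_morphism comul;
  counit_linear : scalar counit;
  counit_morph : monoid_morphism counit;
  antipode_linear : linear antipode;
  coassoc : forall x, tassoc (tmap comul id (comul x)) = tmap id comul (comul x);
  counitl : forall x, tlift (fun a b => counit a *: b) (comul x) = x;
  counitr : forall x, tlift (fun a b => counit b *: a) (comul x) = x;
  antipodel : forall x, tlift (fun a b => antipode a * b) (comul x) = (counit x)%:A;
  antipoder : forall x, tlift (fun a b => a * antipode b) (comul x) = (counit x)%:A
}.

Record hopf_iso (K : fieldType) (A B : algType K) (hA : hopf A) (hB : hopf B)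
    (psi : A -> B) : Prop := HopfIso {
  hopf_iso_linear : linear psi;
  hopf_iso_morph : monoid_morphism psi;
  hopf_iso_bij : bijective psi;
  hopf_iso_comul : forall x, comul hB (psi x) = tmap psi psi (comul hA x);
  hopf_iso_counit : forall x, counit hB (psi x) = counit hA x;
  hopf_iso_antipode : forall x, antipode hB (psi x) = psi (antipode hA x)
}.

Definition is_basis (K : fieldType) (V : lmodType K) (X : choiceType) (b : X -> V) :=
  forall w : V, exists! c : {fsfun X -> K with 0},
    w = \sum_(x <- finsupp c) c x *: b x.

(* The field Q(v^{1/2}), as the fraction field of Q[X] with X = v^{1/2}. *)
Definition Kv : fieldType := {fraction {poly rat}}.
Definition vh : Kv := tofrac 'X.
Definition v : Kv := vh ^+ 2.

(* [Laurent p n] stands for z^-n p(z); the representation is not unique, and only *)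
(* the values [leval] matter.                                                    *)
Record laurent := Laurent { lnum : {poly int}; lden : nat }.
Definition leval (L : fieldType) (p : laurent) (z : L) : L :=
  (map_poly intr (lnum p)).[z] / z ^+ lden p.

Definition qint (n : nat) : Kv := (v ^+ n - v ^- n) / (v - v^-1).
Definition qfact (n : nat) : Kv := \prod_(k < n) qint k.+1.
Definition qbinom (n r : nat) : Kv := qfact n / (qfact r * qfact (n - r)).

Record quiver := Quiver {
  vert : finType;
  arrow : finType;
  src : arrow -> vert;
  tgt : arrow -> vert
}.

Inductive dynkin_type := TypeA of nat | TypeD of nat | TypeE6 | TypeE7 | TypeE8.

Definition dynkin_rank (t : dynkin_type) : nat :=
  match t with
  | TypeA n => n.+1 | TypeD n => n.+4
  | TypeE6 => 6 | TypeE7 => 7 | TypeE8 => 8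
  end.

(* Branches at vertex [r - 3] of the path 0 - 1 - ... - (r - 2) for D_r, and at *)
(* vertex 2 of that path for E_r.                                               *)
Definition dynkin_edge (t : dynkin_type) (i j : nat) : bool :=
  let r := dynkin_rank t in
  let branched b :=
    (i.+1 == j) && (j < r.-1)%N || (i == b) && (j == r.-1) in
  match t with
  | TypeA _ => i.+1 == j
  | TypeD _ => branched (r - 3)%N
  | _ => branched 2
  end.

Definition is_dynkin (Q : quiver) : Prop :=
  exists (t : dynkin_type) (num : vert Q -> 'I_(dynkin_rank t)),
    bijective num /\
    forall i j : vert Q,
      #|[set a : arrow Q | ((src a == i) && (tgt a == j))
                        || ((src a == j) && (tgt a == i))]|
      = dynkin_edge t (num i) (num j) || dynkin_edge t (num j) (num i).

Section Lattice.
Variable Q : quiver.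

Definition lattice := {ffun vert Q -> int}.

Definition simple_root (i : vert Q) : lattice := [ffun j => (i == j)%:R].

Definition euler (x y : lattice) : int :=
  \sum_i x i * y i - \sum_a x (src a) * y (tgt a).

Definition eulers (x y : lattice) : int := euler x y + euler y x.

Definition cartan (i j : vert Q) : int := eulers (simple_root i) (simple_root j).

(* The closure of the simple roots under the simple reflections, i.e., their orbit *)
(* under the Weyl group.                                                           *)
Inductive is_root : lattice -> Prop :=
| root_simple i : is_root (simple_root i)
| root_reflect i x : is_root x -> is_root (x - simple_root i *~ eulers x (simple_root i)).

Definition posroot_pred : pred lattice :=
  fun x => `[< is_root x /\ forall i, 0 <= x i >].
Definition proot := {x : lattice | posroot_pred x}.

(* For a Dynkin quiver (or a disjoint union of such) [proot] is finite, so these   *)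
(* are all the functions from positive roots to nat.                               *)
Definition kostant := {fsfun proot -> nat with 0%N}.

Definition dimvec (l : kostant) : lattice := \sum_(b <- finsupp l) val b *+ l b.

Lemma simple_posroot i : posroot_pred (simple_root i).
Proof.
by apply/asboolP; split=> [|j]; [exact: root_simple | rewrite ffunE ler0n].
Qed.
Definition simple_proot i : proot := exist _ (simple_root i) (simple_posroot i).

Definition kostant0 : kostant := [fsfun].
Definition kostant1 (b : proot) : kostant := [fsfun c in [fset b]%fset => 1%N].
Definition kostant_simple i : kostant := kostant1 (simple_proot i).

End Lattice.

Section Reps.
Variables (Q : quiver) (F : finFieldType).

(* Vectors are rows; the arrow [a] acts by [u |-> u *m rmap X a]. *)
Record rep := Rep {
  rdim : vert Q -> nat;
  rmap : forall a : arrow Q, 'M[F]_(rdim (src a), rdim (tgt a))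
}.

Definition rephom (X Y : rep) := {dffun forall k : vert Q, 'M[F]_(rdim X k, rdim Y k)}.

Definition is_rephom (X Y : rep) (f : rephom X Y) : bool :=
  [forall a, rmap X a *m f (tgt a) == f (src a) *m rmap Y a].
Definition is_mono (X Y : rep) (f : rephom X Y) := is_rephom f && [forall k, row_free (f k)].
Definition is_epi (X Y : rep) (f : rephom X Y) := is_rephom f && [forall k, row_full (f k)].
Definition is_iso (X Y : rep) (f : rephom X Y) := is_mono f && is_epi f.
Definition isomorphic (X Y : rep) := [exists f : rephom X Y, is_iso f].

Definition rep0 : rep := @Rep (fun=> 0%N) (fun=> 0).
Definition rsum (X Y : rep) : rep :=
  @Rep (fun k => rdim X k + rdim Y k)%N
       (fun a => block_mx (rmap X a) 0 0 (rmap Y a)).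

Definition is_rep0 (X : rep) := [forall k, rdim X k == 0%N].
Definition indecomposable (X : rep) : Prop :=
  ~~ is_rep0 X /\
  forall X1 X2 : rep, isomorphic X (rsum X1 X2) -> is_rep0 X1 || is_rep0 X2.

(* Subspaces are given by their sets of vectors. *)
Definition subspaces (Y : rep) := {dffun forall k : vert Q, {set 'rV[F]_(rdim Y k)}}.

Definition subrep (Y : rep) (L : subspaces Y) : bool :=
  [forall k, (0 \in L k) &&
     [forall c : F, [forall u in L k, [forall w in L k, c *: u + w \in L k]]]]
  && [forall a, [forall u in L (src a), u *m rmap Y a \in L (tgt a)]].

Definition sub_iso (Y Z : rep) (L : subspaces Y) : bool :=
  [exists f : rephom Z Y, is_mono f &&
     [forall k, L k == [set u *m f k | u : 'rV[F]_(rdim Z k)]]].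

(* An isomorphism Y/L -> X is the same thing as an epimorphism Y -> X of kernel L. *)
Definition quo_iso (Y X : rep) (L : subspaces Y) : bool :=
  [exists f : rephom Y X, is_epi f &&
     [forall k, L k == [set u | u *m f k == 0]]].

(* F_{XZ}^Y: subrepresentations L of Y with L ~ Z and Y/L ~ X. *)
Definition hallF (X Z Y : rep) : nat :=
  #|[set L : subspaces Y | [&& subrep L, sub_iso Z L & quo_iso X L]]|.

(* An element of Ext^1(X, Z) with middle term isomorphic to Y is a class of short    *)
(* exact sequences 0 -> Z -> Y -> X -> 0 for the Yoneda equivalence, which here       *)
(* allows all automorphisms of Y.                                                     *)
Definition shortexact (X Z Y : rep) : {set rephom Z Y * rephom Y X} :=
  [set e | [&& is_mono e.1, is_epi e.2 &
             [forall k, (e.1 k == kermx (e.2 k))%MS]]].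

Definition ext_equiv (X Z Y : rep) : rel (rephom Z Y * rephom Y X) := fun e e' =>
  [exists f : rephom Y Y, [&& is_iso f,
     [forall k, e.1 k *m f k == e'.1 k] & [forall k, f k *m e'.2 k == e.2 k]]].

Definition ext_mid (X Z Y : rep) :=
  equivalence_partition (@ext_equiv X Z Y) (shortexact X Z Y).

Definition hallG (X Z Y : rep) : algC :=
  #|ext_mid X Z Y|%:R / #|[set f : rephom X Z | is_rephom f]|%:R.

Definition autnum (X : rep) : nat := #|[set f : rephom X X | is_iso f]|.

Definition rep_of (M : proot Q -> rep) (l : kostant Q) : rep :=
  foldr rsum rep0 (flatten [seq nseq (l b) (M b) | b <- finsupp l]).

End Reps.

(* The indecomposables M_q(beta) over every finite field, with Hall polynomials: *)
(* [hf l m n] is f_{l,m}^n, [hg l m n] is g_{l,m}^n and [ha l] is a_l; they are  *)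
(* specified by their values at the positive square root of q = #|F|.            *)
Record hall_data (Q : quiver) := HallData {
  hallM : forall F : finFieldType, proot Q -> rep Q F;
  hallM_indec : forall (F : finFieldType) b, indecomposable (hallM F b);
  hallM_dim : forall (F : finFieldType) b k, (rdim (hallM F b) k)%:Z = val b k;
  hf : kostant Q -> kostant Q -> kostant Q -> laurent;
  hg : kostant Q -> kostant Q -> kostant Q -> laurent;
  ha : kostant Q -> laurent;
  hfE : forall (F : finFieldType) l m n,
    leval (hf l m n) (sqrtC #|F|%:R : algC) =
    (hallF (rep_of (hallM F) l) (rep_of (hallM F) m) (rep_of (hallM F) n))%:R;
  hgE : forall (F : finFieldType) l m n,
    leval (hg l m n) (sqrtC #|F|%:R : algC) =
    hallG (rep_of (hallM F) l) (rep_of (hallM F) m) (rep_of (hallM F) n);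
  haE : forall (F : finFieldType) l,
    leval (ha l) (sqrtC #|F|%:R : algC) = (autnum (rep_of (hallM F) l))%:R
}.

Section HallPolynomials.
Variables (Q : quiver) (D : hall_data Q).
Definition fpol (l m n : kostant Q) : Kv := leval (hf D l m n) v.
Definition gpol (l m n : kostant Q) : Kv := leval (hg D l m n) v.
Definition apol (l : kostant Q) : Kv := leval (ha D l) v.
Definition fpol3 (l1 l2 l3 l : kostant Q) : Kv :=
  \sum_(m \in [set: kostant Q]%classic) fpol l1 m l * fpol l2 l3 m.
End HallPolynomials.

Record involution (Q : quiver) := Involution {
  invv : vert Q -> vert Q;
  inva : arrow Q -> arrow Q;
  invvK : involutive invv;
  invaK : involutive inva;
  inv_src : forall a, src (inva a) = invv (src a);
  inv_tgt : forall a, tgt (inva a) = invv (tgt a)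
}.

Section Involution.
Variables (Q : quiver) (rho : involution Q).

Definition inv_lat (x : lattice Q) : lattice Q := [ffun i => x (invv rho i)].

Fact inv_lat_zmod : zmod_morphism inv_lat.
Proof. by move=> x y; apply/ffunP=> i; rewrite !ffunE. Qed.
HB.instance Definition _ :=
  GRing.isZmodMorphism.Build (lattice Q) (lattice Q) inv_lat inv_lat_zmod.

Lemma inv_latK : involutive inv_lat.
Proof. by move=> x; apply/ffunP=> i; rewrite !ffunE invvK. Qed.

Lemma inv_lat_simple i : inv_lat (simple_root i) = simple_root (invv rho i).
Proof.
apply/ffunP=> j; rewrite !ffunE.
by rewrite -(inj_eq (inv_inj (@invvK _ rho))) invvK.
Qed.

Lemma euler_inv x y : euler (inv_lat x) (inv_lat y) = euler x y.
Proof.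
rewrite /euler; congr (_ - _).
  rewrite [RHS](reindex_inj (inv_inj (@invvK _ rho))).
  by apply: eq_bigr => i _; rewrite !ffunE.
rewrite [RHS](reindex_inj (inv_inj (@invaK _ rho))).
by apply: eq_bigr => a _; rewrite !ffunE inv_src inv_tgt.
Qed.

Lemma is_root_inv x : is_root x -> is_root (inv_lat x).
Proof.
elim=> [i|i {}x _ IH]; first by rewrite inv_lat_simple; exact: root_simple.
rewrite raddfB raddfMz /= /eulers -euler_inv -[euler (simple_root i) x]euler_inv.
by rewrite inv_lat_simple; exact: root_reflect.
Qed.

Lemma posroot_inv x : posroot_pred x -> posroot_pred (inv_lat x).
Proof.
move=> /asboolP [rx px]; apply/asboolP; split; first exact: is_root_inv.
by move=> i; rewrite ffunE.
Qed.

Definition inv_root (b : proot Q) : proot Q :=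
  exist _ (inv_lat (val b)) (posroot_inv (valP b)).

Definition inv_kostant (l : kostant Q) : kostant Q :=
  [fsfun b in [fset inv_root c | c in finsupp l]%fset => l (inv_root b)].

End Involution.

(* Below, sums [\sum_(x \in A)] are the finitely supported sums of fsbigop. *)
Section IHall.
Variables (Q : quiver) (rho : involution Q) (D : hall_data Q).
Variables (H : algType Kv) (KK : lattice Q -> H) (uu : kostant Q -> H).

Local Notation "<[ x , y ]>" := (euler x y).

Definition ihall_coef (l m th nu ga de : kostant Q) : Kv :=
  v ^ (<[dimvec de, dimvec th]> - <[inv_lat rho (dimvec de), dimvec th]>
       - <[dimvec l, dimvec m]> + 2 * <[dimvec nu, dimvec ga]>)
  * apol D de * fpol D de nu l * fpol D ga (inv_kostant rho de) m
  * gpol D nu ga th.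

Record is_ihall : Prop := IsIHall {
  ihall_basis :
    is_basis (fun x : (lattice Q * kostant Q)%type => KK x.1 * uu x.2);
  ihall_K0 : KK 0 = 1;
  ihall_u0 : uu (kostant0 Q) = 1;
  ihall_KK : forall a b, KK a * KK b = KK (a + b);
  ihall_Ku : forall a l, KK a * uu l =
    v ^ (eulers (inv_lat rho a) (dimvec l) - eulers a (dimvec l)) *: (uu l * KK a);
  ihall_uu : forall l m, uu l * uu m =
    \sum_(x \in [set: kostant Q * kostant Q * kostant Q * kostant Q]%classic)
      let: (th, nu, ga, de) := x in
      ihall_coef l m th nu ga de *: (KK (dimvec de) * uu th)
}.

End IHall.

Section Double.
Variable Q : quiver.

Definition dbl : quiver := @Quiver (vert Q + vert Q)%type (arrow Q + arrow Q)%type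
  (fun a => match a with inl b => inl (src b) | inr b => inr (src b) end)
  (fun a => match a with inl b => inl (tgt b) | inr b => inr (tgt b) end).

Definition flip (T : Type) (x : T + T) : T + T :=
  match x with inl y => inr y | inr y => inl y end.

Fact flipK (T : Type) : involutive (@flip T). Proof. by case. Qed.
Fact flip_src (a : arrow dbl) : src (flip a : arrow dbl) = flip (src a) :> vert dbl.
Proof. by case: a. Qed.
Fact flip_tgt (a : arrow dbl) : tgt (flip a : arrow dbl) = flip (tgt a) :> vert dbl.
Proof. by case: a. Qed.

Definition swap : involution dbl := @Involution dbl (@flip (vert Q))
  (@flip (arrow Q)) (@flipK _) (@flipK _) flip_src flip_tgt.

(* [s = false] selects Q and [s = true] selects its copy in [dbl]. *)
Definition emb (s : bool) (i : vert Q) : vert dbl := if s then inr i else inl i.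

Definition emb_lat (s : bool) (x : lattice Q) : lattice dbl :=
  [ffun k : vert dbl => match k with
    | inl i => if s then 0 else x i
    | inr i => if s then x i else 0 end].

Fact emb_lat_zmod s : zmod_morphism (emb_lat s).
Proof.
by move=> x y; apply/ffunP=> -[] i; rewrite !ffunE; case: s; rewrite ?subr0.
Qed.
HB.instance Definition _ s :=
  GRing.isZmodMorphism.Build (lattice Q) (lattice dbl) (emb_lat s) (emb_lat_zmod s).

Lemma emb_lat_simple s i : emb_lat s (simple_root i) = simple_root (emb s i).
Proof. by case: s; apply/ffunP=> -[] j; rewrite !ffunE. Qed.

Lemma euler_emb s x y : euler (emb_lat s x) (emb_lat s y) = euler x y.
Proof.
rewrite /euler !big_sumType /=; congr (_ - _); case: s.
- by rewrite big1 ?add0r => [|i _]; [apply: eq_bigr => i _ |]; rewrite !ffunE ?mul0r.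
- by rewrite [X in _ + X]big1 ?addr0 => [|i _]; [apply: eq_bigr => i _ |];
    rewrite !ffunE ?mul0r.
- by rewrite big1 ?add0r => [|i _]; [apply: eq_bigr => i _ |]; rewrite !ffunE ?mul0r.
- by rewrite [X in _ + X]big1 ?addr0 => [|i _]; [apply: eq_bigr => i _ |];
    rewrite !ffunE ?mul0r.
Qed.

Lemma is_root_emb s x : is_root x -> is_root (emb_lat s x).
Proof.
elim=> [i|i {}x _ IH]; first by rewrite emb_lat_simple; exact: root_simple.
rewrite raddfB raddfMz /= /eulers -(euler_emb s) -(euler_emb s (simple_root i)).
by rewrite emb_lat_simple; exact: root_reflect.
Qed.

Lemma posroot_emb s x : posroot_pred x -> posroot_pred (emb_lat s x).
Proof.
move=> /asboolP [rx px]; apply/asboolP; split; first exact: is_root_emb.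
by case=> i; rewrite ffunE; case: s.
Qed.

Definition emb_root s (b : proot Q) : proot dbl :=
  exist _ (emb_lat s (val b)) (posroot_emb s (valP b)).

(* The function attached to M(l) (+) M(m)^diamond. *)
Definition kostant_dbl (l m : kostant Q) : kostant dbl :=
  [fsfun b in ([fset emb_root false c | c in finsupp l]
               `|` [fset emb_root true c | c in finsupp m])%fset =>
     (\sum_(c <- finsupp l | emb_root false c == b) l c
      + \sum_(c <- finsupp m | emb_root true c == b) m c)%N].

End Double.

Section DoubleCoproduct.
Variables (Q : quiver) (D : hall_data Q) (H : algType Kv).
Variables (KK : lattice (dbl Q) -> H) (uu : kostant (dbl Q) -> H) (hH : hopf H).

Local Notation "<[ x , y ]>" := (euler x y).
Local Notation d := (@dimvec Q).

Definition dblK (a : lattice Q) : H := KK (emb_lat false a).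
Definition dblKd (a : lattice Q) : H := KK (emb_lat true a).
Definition dblu (l m : kostant Q) : H := uu (kostant_dbl l m).

Definition dbl_coef (l m l1 l2 m1 m2 nu : kostant Q) : Kv :=
  v ^ (<[d l1, d l2 + d nu]> + <[d m1, d m2 + d nu]> - <[d l2 + d m2, d nu]>
       - eulers (d l2) (d m2))
  * apol D nu * fpol3 D l1 nu l2 l * fpol3 D m1 nu m2 m.

Record is_dbl_hopf : Prop := IsDblHopf {
  dbl_comulK : forall a, comul hH (dblK a) = tpure (dblK a) (dblK a);
  dbl_comulKd : forall a, comul hH (dblKd a) = tpure (dblKd a) (dblKd a);
  dbl_comulu : forall l m, comul hH (dblu l m) =
    \sum_(x \in [set: kostant Q * kostant Q * kostant Q * kostant Q * kostant Q]%classic)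
      let: (l1, l2, m1, m2, nu) := x in
      dbl_coef l m l1 l2 m1 m2 nu *:
        tpure (dblu l1 m2 * dblKd (d l2 + d nu)) (dblu l2 m1 * dblK (d m2 + d nu))
}.

End DoubleCoproduct.

Section Characters.
Variables (K : fieldType) (A : algType K) (e : A -> K).
Hypotheses (eB : zmod_morphism e) (e1 : e 1 = 1).
Hypotheses (eM : forall x y, e (x * y) = e x * e y).
Hypotheses (eZ : forall c x, e (c *: x) = c * e x).

Lemma char_comm x y : e (x * y - y * x) = 0.
Proof. by rewrite eB !eM mulrC subrr. Qed.

Lemma char_inv x y : e x = 1 -> e y = 1 -> e (x * y - 1) = 0.
Proof. by move=> ex ey; rewrite eB eM e1 ex ey mul1r subrr. Qed.

Lemma char_qcomm c x y : e y = 0 -> e (x * y - c *: (y * x)) = 0.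
Proof. by move=> ey; rewrite eB eZ !eM ey mul0r !mulr0 subrr. Qed.

Lemma char_EF c x y k k' : e k = 1 -> e k' = 1 ->
  e (x * y - y * x - c *: (k - k')) = 0.
Proof.
by move=> ek ek'; rewrite eB char_comm eZ eB ek ek' subrr mulr0 subrr.
Qed.
End Characters.

Inductive ugen (I : Type) :=
| genE of I | genF of I | genK of I | genKinv of I | genK' of I | genK'inv of I.
HB.instance Definition _ (I : Type) := gen_eqMixin (ugen I).
HB.instance Definition _ (I : Type) := gen_choiceMixin (ugen I).

Section QuantumGroup.
Variable Q : quiver.
Local Notation FA := (freealg Kv (ugen (vert Q))).
Local Notation g c := (fgen Kv c : FA).

Definition serre (X : vert Q -> FA) (i j : vert Q) : FA :=
  let N := `|1 - cartan i j|%N in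
  \sum_(r < N.+1) ((-1) ^+ r * qbinom N r) *: (X i ^+ r * X j * X i ^+ (N - r)).

Inductive u_rel : FA -> Prop :=
| u_rel_EF i j : u_rel (g (genE i) * g (genF j) - g (genF j) * g (genE i)
    - ((i == j)%:R * (v^-1 - v)) *: (g (genK i) - g (genK' i)))
| u_rel_KV i : u_rel (g (genK i) * g (genKinv i) - 1)
| u_rel_VK i : u_rel (g (genKinv i) * g (genK i) - 1)
| u_rel_K'V i : u_rel (g (genK' i) * g (genK'inv i) - 1)
| u_rel_VK' i : u_rel (g (genK'inv i) * g (genK' i) - 1)
| u_rel_KK i j : u_rel (g (genK i) * g (genK j) - g (genK j) * g (genK i))
| u_rel_KK' i j : u_rel (g (genK i) * g (genK' j) - g (genK' j) * g (genK i))
| u_rel_K'K' i j : u_rel (g (genK' i) * g (genK' j) - g (genK' j) * g (genK' i))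
| u_rel_KE i j : u_rel (g (genK i) * g (genE j)
    - v ^ cartan i j *: (g (genE j) * g (genK i)))
| u_rel_KF i j : u_rel (g (genK i) * g (genF j)
    - v ^ (- cartan i j) *: (g (genF j) * g (genK i)))
| u_rel_K'E i j : u_rel (g (genK' i) * g (genE j)
    - v ^ (- cartan i j) *: (g (genE j) * g (genK' i)))
| u_rel_K'F i j : u_rel (g (genK' i) * g (genF j)
    - v ^ cartan i j *: (g (genF j) * g (genK' i)))
| u_rel_serreE i j : i != j -> u_rel (serre (fun k => g (genE k)) i j)
| u_rel_serreF i j : i != j -> u_rel (serre (fun k => g (genF k)) i j).

Definition Utilde := aquot u_rel.
HB.instance Definition _ := GRing.PzRing.on Utilde.
HB.instance Definition _ := GRing.Lmodule.on Utilde.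

Definition ucounit (c : ugen (vert Q)) : Kv :=
  match c with genE _ | genF _ => 0 | _ => 1 end.

Fact ucounit_serre (X : vert Q -> FA) i j :
  aug ucounit (X j) = 0 -> aug ucounit (serre X i j) = 0.
Proof.
move=> Xj0.
rewrite /serre (big_morph (aug ucounit) (rmorphD (aug ucounit)) (rmorph0 (aug ucounit))).
by apply: big1 => r _; rewrite augZ !augM Xj0 mulr0 mul0r mulr0.
Qed.

(* Algebras of type [algType] are nonzero by definition. *)
Lemma Utilde_nontrivial : (1 : Utilde) != 0.
Proof.
have eB : zmod_morphism (aug ucounit : FA -> Kv).
  by move=> x y; exact: (raddfB (aug ucounit)).
have e1 : aug ucounit (1 : FA) = 1 by exact: (rmorph1 (aug ucounit)).
have eM x y : aug ucounit (x * y : FA) = aug ucounit x * aug ucounit y by exact: augM.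
have eZ c x : aug ucounit (c *: x : FA) = c * aug ucounit x by exact: augZ.
apply: (aquot_nontrivial (e := ucounit)) => r; case=> *.
- by apply: (char_EF eB eM eZ); exact: aug_gen.
- by apply: (char_inv eB e1 eM); exact: aug_gen.
- by apply: (char_inv eB e1 eM); exact: aug_gen.
- by apply: (char_inv eB e1 eM); exact: aug_gen.
- by apply: (char_inv eB e1 eM); exact: aug_gen.
- exact: (char_comm eB eM).
- exact: (char_comm eB eM).
- exact: (char_comm eB eM).
- by apply: (char_qcomm eB eM eZ); exact: aug_gen.
- by apply: (char_qcomm eB eM eZ); exact: aug_gen.
- by apply: (char_qcomm eB eM eZ); exact: aug_gen.
- by apply: (char_qcomm eB eM eZ); exact: aug_gen.
- by apply: ucounit_serre; exact: aug_gen.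
- by apply: ucounit_serre; exact: aug_gen.
Qed.
HB.instance Definition _ :=
  GRing.PzSemiRing_isNonZero.Build Utilde Utilde_nontrivial.
HB.instance Definition _ :=
  GRing.Lmodule_isLalgebra.Build Kv Utilde (@aquot_scaleAl _ _ u_rel).
HB.instance Definition _ :=
  GRing.Lalgebra_isAlgebra.Build Kv Utilde (@aquot_scaleAr _ _ u_rel).

(* The generators E_i, F_i, K_i, ... of the quantum group. *)
Definition ug (c : ugen (vert Q)) : Utilde := aquot_pi u_rel (g c).

Local Notation E i := (ug (genE i)).
Local Notation F i := (ug (genF i)).
Local Notation K i := (ug (genK i)).
Local Notation Kinv i := (ug (genKinv i)).
Local Notation K' i := (ug (genK' i)).
Local Notation K'inv i := (ug (genK'inv i)).

Record is_Utilde_hopf (h : hopf Utilde) : Prop := IsUtildeHopf {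
  comulE : forall i, comul h (E i) = tpure (E i) 1 + tpure (K i) (E i);
  comulF : forall i, comul h (F i) = tpure 1 (F i) + tpure (F i) (K' i);
  comulK : forall i, comul h (K i) = tpure (K i) (K i);
  comulK' : forall i, comul h (K' i) = tpure (K' i) (K' i);
  counitE : forall i, counit h (E i) = 0;
  counitF : forall i, counit h (F i) = 0;
  counitK : forall i, counit h (K i) = 1;
  counitK' : forall i, counit h (K' i) = 1;
  antipodeE : forall i, antipode h (E i) = - (Kinv i * E i);
  antipodeF : forall i, antipode h (F i) = - (F i * K'inv i);
  antipodeK : forall i, antipode h (K i) = Kinv i;
  antipodeK' : forall i, antipode h (K' i) = K'inv i
}.

End QuantumGroup.

(* Main.v *)
From HB Require Import structures.
Require Import Defs.
From mathcomp Require Import all_boot all_order all_algebra all_field.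
From mathcomp Require Import finmap boolp classical_sets fsbigop monalg.

Set Implicit Arguments.
Unset Strict Implicit.
Unset Printing Implicit Defensive.

Import Order.TTheory GRing.Theory Num.Theory.
Local Open Scope ring_scope.

(** A bijective algebra map that respects the coproducts respects the rest of a
    Hopf structure: a counit is the two-sided unit dual to the coproduct, hence
    unique ([counit_unique]), and an antipode is the inverse of the identity for
    convolution, hence unique as well ([convolution_inverse_unique]). So only the
    compatibility of [psi] with the coproducts is at stake
    ([bialgebra_iso_hopf_iso]). Both composites from the quantum group to the
    tensor square of the Hall algebra are algebra maps, so they agree once they
    agree on the generators E_i, F_i, K_i, K'_i; the values on the inverses of
    K_i and K'_i follow ([Utilde_morphism_ext]).

    The K_i and K'_i are group-like on both sides. For E_i and F_i the five-fold
    sum defining the coproduct of u_(alpha_i) has to be evaluated. A Hall number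
    F_{XZ}^Y is nonzero only if dim Y = dim X + dim Z ([hallF_dim]). A Laurent
    polynomial which takes a constant value c at the square roots of the orders of
    all finite fields takes the value c at v too ([leval_constant]), so the generic
    f_{l,m}^n obeys the same restriction. As every positive root is a nonzero
    vector with nonnegative entries, a multiplicity function of dimension vector 0
    or alpha_i is 0 or the simple root itself ([dimvec_eq0], [dimvec_eq_simple]):
    this replaces any appeal to the Krull-Schmidt theorem. Hence only two terms of
    the sum survive; their coefficients are 1, because F_{Y0}^Y = F_{0Y}^Y = 1 and
    Aut(0) is trivial, and the two terms are those of the coproduct of E_i or F_i
    ([comul_dblu_simplel], [comul_dblu_simpler]). *)

(** * Linear maps out of tensor products *)

Section TensorMaps.
Variable K : fieldType.

Lemma linear_propD (U V : lmodType K) (f : U -> V) : linear f -> {morph f : x y / x + y}.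
Proof. by move=> lf x y; rewrite -[x in LHS]scale1r lf scale1r. Qed.

Lemma linear_propZ (U V : lmodType K) (f : U -> V) c x :
  linear f -> f (c *: x) = c *: f x.
Proof.
move=> lf; have f0 : f 0 = 0.
  by apply: (addrI (f 0)); rewrite -(linear_propD lf) !addr0.
by rewrite -[c *: x]addr0 lf f0 addr0.
Qed.

Lemma tpure_map_bilin (A B A' B' : lmodType K)
    (f : {linear A -> A'}) (g : {linear B -> B'}) :
  bilin (fun a b => tpure (f a) (g b)).
Proof.
split=> [b c a a'|a c b b'] /=; rewrite linearP.
  exact: (tpure_bilin A' B').1.
exact: (tpure_bilin A' B').2.
Qed.

Lemma tmap_linear (A B A' B' : lmodType K)
    (f : {linear A -> A'}) (g : {linear B -> B'}) : linear (tmap f g).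
Proof. exact/tlift_linear/tpure_map_bilin. Qed.

Lemma tmap_pure (A B A' B' : lmodType K)
    (f : {linear A -> A'}) (g : {linear B -> B'}) a b :
  tmap f g (tpure a b) = tpure (f a) (g b).
Proof. exact: (tlift_pure (tpure_map_bilin f g)). Qed.

(** The tensor square carries a ring and a module structure but no packaged algebra
    structure, so linearity of multiplication is recorded by hand. *)
Lemma tensM_linearl (A B : algType K) (y : tens A B) :
  linear (fun x : tens A B => (x * y : tens A B)).
Proof. exact: tmul_linearl. Qed.

Lemma tensM_linearr (A B : algType K) (x : tens A B) :
  linear (fun y : tens A B => (x * y : tens A B)).
Proof. exact: tmul_linearr. Qed.

Lemma linear_compose (U V W : lmodType K) (f : V -> W) (g : U -> V) :
  linear f -> linear g -> linear (fun x => f (g x)).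
Proof. by move=> lf lg c x y; rewrite lg lf. Qed.

Lemma tmap_monoid_morphism (A B : algType K) (f : {lrmorphism A -> B}) :
  monoid_morphism (tmap f f).
Proof.
split=> [|x y].
  by rewrite -[1]/(tpure 1 1) tmap_pure rmorph1.
have fL := tmap_linear f f.
move: x; apply: (tens_linear_ext (f := fun x => tmap f f (x * y))
  (g := fun x => tmap f f x * tmap f f y)) => [||a b].
- exact: (linear_compose fL (tensM_linearl y)).
- exact: (linear_compose (tensM_linearl _) fL).
move: y; apply: (tens_linear_ext (f := fun y => tmap f f (tpure a b * y))
  (g := fun y => tmap f f (tpure a b) * tmap f f y)) => [||a' b'].
- exact: (linear_compose fL (tensM_linearr _)).
- exact: (linear_compose (tensM_linearr _) fL).
by rewrite tpureM !tmap_pure tpureM !rmorphM.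
Qed.

Lemma linear_tlift (A B M N : lmodType K) (h : {linear M -> N})
    (p : A -> B -> M) (q : A -> B -> N) (x : tens A B) :
  bilin p -> (forall a b, h (p a b) = q a b) -> h (tlift p x) = tlift q x.
Proof.
move=> pB pq; have qB : bilin q.
  by split=> [b c a a'|a c b b']; rewrite -!pq ?pB.1 ?pB.2 linearP.
move: x; apply: (tens_linear_ext (f := fun x => h (tlift p x))) => [c x y||a b].
- by rewrite (tlift_linear pB) linearP.
- exact: tlift_linear qB.
by rewrite (tlift_pure pB) (tlift_pure qB).
Qed.

(** Naturality of the universal property; with a coproduct fed to [x], this is how
    Sweedler sums are transported along linear maps. *)
Lemma linear_tlift_map (A B A' B' M N : lmodType K)
    (f : {linear A -> A'}) (g : {linear B -> B'}) (h : {linear M -> N})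
    (p : A -> B -> M) (p' : A' -> B' -> N) (x : tens A B) :
  bilin p -> bilin p' -> (forall a b, p' (f a) (g b) = h (p a b)) ->
  tlift p' (tmap f g x) = h (tlift p x).
Proof.
move=> pB p'B pp'; move: x.
apply: (tens_linear_ext (f := fun x => tlift p' (tmap f g x))
  (g := fun x => h (tlift p x))) => [c x y|c x y|a b].
- by rewrite tmap_linear tlift_linear.
- by rewrite (tlift_linear pB) linearP.
by rewrite tmap_pure !tlift_pure.
Qed.

Section Associator.
Variables A B C : lmodType K.

Let assoc2 (c : C) (a : A) (b : B) : tens A (tens B C) := tpure a (tpure b c).

Let assoc2_bilin c : bilin (assoc2 c).
Proof.
split=> [b k u w|a k u w]; rewrite /assoc2; first exact: (tpure_bilin _ _).1.
have -> : tpure (k *: u + w) c = k *: tpure u c + tpure w c by exact: (tpure_bilin B C).1.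
exact: (tpure_bilin A (tens B C)).2.
Qed.

Let assoc_bilin : bilin (fun (ab : tens A B) c => tlift (assoc2 c) ab).
Proof.
split=> [c|y k c d]; first exact: (tlift_linear (assoc2_bilin c)).
move: y; apply: (tens_linear_ext (f := tlift (assoc2 (k *: c + d)))
  (g := fun y => k *: tlift (assoc2 c) y + tlift (assoc2 d) y)) => [||a b].
- exact: (tlift_linear (assoc2_bilin _)).
- by apply: linear_comb; exact: (tlift_linear (assoc2_bilin _)).
have E c' : tlift (assoc2 c') (tpure a b) = assoc2 c' a b by exact: (tlift_pure (assoc2_bilin c')).
transitivity (k *: assoc2 c a b + assoc2 d a b); last first.
  by congr (_ *: _ + _); apply/esym/E.
apply: (etrans (E _)); rewrite /assoc2.
have -> : tpure b (k *: c + d) = k *: tpure b c + tpure b d by exact: (tpure_bilin B C).2.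
exact: (tpure_bilin A (tens B C)).2.
Qed.

Lemma tassoc_linear : linear (@tassoc K A B C).
Proof. exact: (tlift_linear assoc_bilin). Qed.

Lemma tassoc_pure a b c :
  tassoc (tpure (tpure a b) c) = tpure a (tpure b c) :> tens A (tens B C).
Proof. by rewrite /tassoc (tlift_pure assoc_bilin) (tlift_pure (assoc2_bilin c)). Qed.

(** Triple tensors are spanned by pure ones; the coassociativity axiom is exploited
    by comparing linear maps on such triples. *)
Lemma tens3_linear_ext (M : lmodType K) (f g : tens (tens A B) C -> M) :
    linear f -> linear g ->
    (forall a b c, f (tpure (tpure a b) c) = g (tpure (tpure a b) c)) ->
  f =1 g.
Proof.
move=> lf lg fg; apply: tens_linear_ext => // y c; move: y.
have lc : linear (fun y : tens A B => tpure y c) := (tpure_bilin _ _).1 c.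
apply: (tens_linear_ext (f := fun y => f (tpure y c))
  (g := fun y => g (tpure y c))) => //; exact: linear_compose.
Qed.

End Associator.

End TensorMaps.

(** * Uniqueness of counits and antipodes *)

Section Uniqueness.
Variables (K : fieldType) (A B : algType K).

Lemma bilin_mulmap (f g : {linear A -> B}) : bilin (fun a b => f a * g b).
Proof.
split=> [b c x y|a c x y] /=; rewrite linearP.
  by rewrite mulrDl scalerAl.
by rewrite mulrDr scalerAr.
Qed.

Lemma bilin_charl (M : lmodType K) (e : {scalar A}) :
  bilin (fun (a : A) (b : M) => e a *: b).
Proof.
split=> [b c x y|a c x y] /=.
  by rewrite linearP scalerDl scalerA.
by rewrite scalerDr !scalerA mulrC.
Qed.

Lemma bilin_charr (M : lmodType K) (e : {scalar A}) :
  bilin (fun (a : M) (b : A) => e b *: a).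
Proof. by have [l r] := bilin_charl M e; split=> x; [exact: r | exact: l]. Qed.

(** In Sweedler notation, e x = e (x1 e' x2) = (e x1) (e' x2) = e' ((e x1) x2) = e' x. *)
Lemma counit_unique (Delta : A -> tens A A) (e e' : {scalar A}) :
    (forall x, tlift (fun a b => e a *: b) (Delta x) = x) ->
    (forall x, tlift (fun a b => e' b *: a) (Delta x) = x) ->
  e =1 e'.
Proof.
move=> el e'r x; rewrite -{1}[x]e'r -{2}[x]el.
move: (Delta x); apply: (tens_linear_ext (M := K^o)
  (f := fun y => e (tlift (fun a b => e' b *: a) y))
  (g := fun y => e' (tlift (fun a b => e a *: b) y))) => [c y z|c y z|a b].
- by rewrite (tlift_linear (bilin_charr _ _)) linearP.
- by rewrite (tlift_linear (bilin_charl _ _)) linearP.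
rewrite (tlift_pure (bilin_charr _ _)) (tlift_pure (bilin_charl _ _)) !linearZ /=.
by rewrite mulrC.
Qed.

Variables (hA : hopf A) (f S T : {linear A -> B}).

(** S = S * (f * T) = (S * f) * T = T for the convolution product, whose associativity
    is the coassociativity of the coproduct. *)
Lemma convolution_inverse_unique :
    (forall x, tlift (fun a b => S a * f b) (comul hA x) = (counit hA x)%:A) ->
    (forall x, tlift (fun a b => f a * T b) (comul hA x) = (counit hA x)%:A) ->
  S =1 T.
Proof.
pose e : {scalar A} := HB.pack (counit hA)
  (GRing.isLinear.Build _ _ _ _ (counit hA) (counit_linear hA)).
pose De : {linear A -> tens A A} := HB.pack (comul hA)
  (GRing.isLinear.Build _ _ _ _ (comul hA) (comul_linear hA)).
move=> Sf fT x.
(* [p] and [q] are the two bracketings of the product S(x1) f(x2) T(x3). *)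
pose p (a : A) (y : tens A A) := S a * tlift (fun b c => f b * T c) y.
pose q (y : tens A A) (c : A) := tlift (fun a b => S a * f b) y * T c.
have pB : bilin p.
  split=> [y c a b|a c y z] /=; rewrite /p.
    by rewrite linearP mulrDl scalerAl.
  by rewrite (tlift_linear (bilin_mulmap _ _)) mulrDr scalerAr.
have qB : bilin q.
  split=> [c k y z|y c a b] /=; rewrite /q.
    by rewrite (tlift_linear (bilin_mulmap _ _)) mulrDl scalerAl.
  by rewrite linearP mulrDr scalerAr.
have pS : tlift p (tmap id (comul hA) (comul hA x)) = S x.
  rewrite -[in RHS](counitr hA x).
  apply: (linear_tlift_map (f := idfun) (g := De) (h := S)) => //.
    exact: (bilin_charr _ e).
  by move=> a b; rewrite /p fT linearZ /= -scalerAr mulr1.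
have qT : tlift q (tmap (comul hA) id (comul hA x)) = T x.
  rewrite -[in RHS](counitl hA x).
  apply: (linear_tlift_map (f := De) (g := idfun) (h := T)) => //.
    exact: (bilin_charl _ e).
  by move=> a b; rewrite /q Sf linearZ /= -scalerAl mul1r.
rewrite -pS -qT -coassoc; move: (tmap _ _ _).
apply: (tens3_linear_ext (f := fun y => tlift p (tassoc y))) => [||a b c].
- by apply: linear_compose; [exact: tlift_linear | exact: tassoc_linear].
- exact: tlift_linear.
rewrite tassoc_pure (tlift_pure pB) (tlift_pure qB) /p /q.
by rewrite !(tlift_pure (bilin_mulmap _ _)) mulrA.
Qed.

End Uniqueness.

Section BialgebraIso.
Variables (K : fieldType) (A B : algType K) (hA : hopf A) (hB : hopf B).
Variable psi : {lrmorphism A -> B}.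
Hypothesis psi_bij : bijective psi.
Hypothesis psi_comul : forall x, comul hB (psi x) = tmap psi psi (comul hA x).

(** Both counits are counits of the coproduct of [A]: injectivity of [psi] reflects the
    counit axiom of [B] into [A]. *)
Lemma bialgebra_iso_counit x : counit hB (psi x) = counit hA x.
Proof.
pose e : {scalar A} := HB.pack (counit hA)
  (GRing.isLinear.Build _ _ _ _ (counit hA) (counit_linear hA)).
pose eB : {scalar B} := HB.pack (counit hB)
  (GRing.isLinear.Build _ _ _ _ (counit hB) (counit_linear hB)).
pose e' : {scalar A} := eB \o psi.
rewrite -[LHS]/(e' x) -[RHS]/(e x); apply/esym/(counit_unique (Delta := comul hA)) => {}x.
  exact: counitl.
apply: (bij_inj psi_bij); rewrite -[RHS](counitr hB) psi_comul.
apply/esym/linear_tlift_map; [exact: bilin_charr|exact: (bilin_charr _ eB)|].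
by move=> a b; rewrite linearZ.
Qed.

(** The two sides are the left and the right convolution inverse of [psi]. *)
Lemma bialgebra_iso_antipode x : antipode hB (psi x) = psi (antipode hA x).
Proof.
pose sA : {linear A -> A} := HB.pack (antipode hA)
  (GRing.isLinear.Build _ _ _ _ (antipode hA) (antipode_linear hA)).
pose sB : {linear B -> B} := HB.pack (antipode hB)
  (GRing.isLinear.Build _ _ _ _ (antipode hB) (antipode_linear hB)).
apply: (@convolution_inverse_unique _ _ _ hA psi (sB \o psi) (psi \o sA)) => {}x.
  rewrite -bialgebra_iso_counit -antipodel psi_comul; apply/esym.
  apply: (linear_tlift_map (h := idfun)) => //; first exact: bilin_mulmap.
  exact: (bilin_mulmap sB idfun).
rewrite -[RHS](rmorph_alg psi) -antipoder.
apply/esym/linear_tlift; first exact: (bilin_mulmap idfun sA).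
by move=> a b; rewrite rmorphM.
Qed.

Lemma bialgebra_iso_hopf_iso : hopf_iso hA hB psi.
Proof.
split=> //.
- exact: linearP.
- split; [exact: rmorph1 | exact: rmorphM].
- exact: bialgebra_iso_counit.
- exact: bialgebra_iso_antipode.
Qed.

End BialgebraIso.

(** * Algebra maps out of the quantum group *)

Section Generation.
Variable Q : quiver.
Local Notation FA := (freealg Kv (ugen (vert Q))).

Lemma Utilde_rel r : u_rel r -> aquot_pi (@u_rel Q) r = 0.
Proof.
move=> ur; rewrite -(linear0 (aquot_pi (@u_rel Q))); apply/lquot_piE.
rewrite subr0 -[r]mulr1 -[r]mul1r; exact/lspan_gen/Twosided.
Qed.

(** The quantum group is spanned by the products of its generators. *)
Lemma Utilde_ind (P : Utilde Q -> Prop) :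
    P 1 -> (forall c x y, P x -> P y -> P (c *: x + y)) ->
    (forall x y, P x -> P y -> P (x * y)) -> (forall c, P (ug c)) ->
  forall x, P x.
Proof.
move=> P1 PD PM Pg.
have P0 : P 0 by rewrite -(addNr 1) -scaleN1r; exact: PD.
pose pi (x : FA) : Utilde Q := aquot_pi (@u_rel Q) x.
have words w : P (pi << FMonom w >>).
  elim: w => [|a w IH].
    have -> : FMonom [::] = mone :> {fmonom ugen (vert Q)} by apply: val_inj; rewrite /= fm1.
    exact: P1.
  suff -> : pi << FMonom (a :: w) >> = ug a * pi << FMonom w >> by apply: PM.
  rewrite /pi /ug -[RHS]/(aquot_mul _ _) aquot_mul_pi; congr aquot_pi.
  rewrite /fgen malgM_def fgmulUU mulr1; congr << _ >>.
  by apply: val_inj; rewrite /= fmM fmU.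
suff Ppi x : P (pi x) by elim/aquot_ind=> x; exact: Ppi.
rewrite [x]monalgE; elim: (msupp x : seq _) => [|w s IH].
  by rewrite big_nil; suff -> : pi 0 = 0 by []; exact: linear0.
rewrite big_cons.
have -> : << x@_w *g w >> = x@_w *: << w >> :> FA.
  by apply/malgP=> k; rewrite mcoeffZ !mcoeffU mulrnAr mulr1.
suff -> y : pi (x@_w *: << w >> + y) = x@_w *: pi << w >> + pi y.
  by apply: PD => //; case: w.
exact: linearP.
Qed.

Section Ext.
Variables (B : pzRingType) (f g : Utilde Q -> B).
Hypotheses (fM : monoid_morphism f) (gM : monoid_morphism g).

(** The relations make K_i and K'_i invertible, and f y = f y (g x g y) = (f y f x) g y = g y. *)
Lemma monoid_morphism_inv_eq (x y : Utilde Q) :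
  x * y = 1 -> y * x = 1 -> f x = g x -> f y = g y.
Proof.
move=> xy yx fgx; rewrite -[f y]mulr1 -gM.1 -xy gM.2 -fgx mulrA -fM.2 yx fM.1.
by rewrite mul1r.
Qed.

(* Stands for linearity of [f] and [g]: the target is only assumed to be a ring, which
   is all that a tensor product of algebras offers. *)
Hypothesis fgD : forall c x y, f x = g x -> f y = g y -> f (c *: x + y) = g (c *: x + y).

Lemma Utilde_morphism_ext :
    (forall i, f (ug (genE i)) = g (ug (genE i))) ->
    (forall i, f (ug (genF i)) = g (ug (genF i))) ->
    (forall i, f (ug (genK i)) = g (ug (genK i))) ->
    (forall i, f (ug (genK' i)) = g (ug (genK' i))) ->
  f =1 g.
Proof.
move=> fgE fgF fgK fgK'; apply: Utilde_ind => [||x y fgx fgy|].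
- by rewrite fM.1 gM.1.
- exact: fgD.
- by rewrite fM.2 gM.2 fgx fgy.
have relV r s : u_rel (r * s - 1) ->
    aquot_pi (@u_rel Q) r * aquot_pi (@u_rel Q) s = 1 :> Utilde Q.
  move=> /Utilde_rel rs; rewrite aquot_piM; apply/eqP; rewrite -subr_eq0; apply/eqP.
  by rewrite -[RHS]rs linearB.
case=> i //.
- exact: (monoid_morphism_inv_eq (relV _ _ (u_rel_KV i)) (relV _ _ (u_rel_VK i)) (fgK i)).
- exact: (monoid_morphism_inv_eq (relV _ _ (u_rel_K'V i)) (relV _ _ (u_rel_VK' i)) (fgK' i)).
Qed.
End Ext.

End Generation.

(** * Generic values of Laurent polynomials *)

Lemma vh_neq0 : vh != 0.
Proof. by rewrite /vh tofrac_eq0 polyX_eq0. Qed.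

Lemma v_neq0 : v != 0.
Proof. by rewrite /v expf_neq0 ?vh_neq0. Qed.

(** Clearing denominators gives an integer polynomial that vanishes at infinitely many
    algebraic numbers, hence is zero, and can then be evaluated at v. *)
Lemma leval_constant (p : laurent) (c : nat) :
    (forall F : finFieldType, leval p (sqrtC #|F|%:R : algC) = c%:R) ->
  leval p v = c%:R :> Kv.
Proof.
move=> pc; pose P : {poly int} := lnum p - c%:R *: 'X^(lden p).
have evalP (L : fieldType) (z : L) : (map_poly intr P).[z]
    = (map_poly intr (lnum p)).[z] - c%:R * z ^+ lden p.
  rewrite /P rmorphB /= linearZ /= map_polyXn hornerE hornerN hornerZ hornerXn.
  by rewrite rmorph_nat.
suff P0 : P = 0.
  have := evalP Kv v; rewrite P0 rmorph0 horner0 => /esym/eqP; rewrite subr_eq0.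
  by move=> /eqP e; rewrite /leval e mulfK // expf_neq0 ?v_neq0.
apply: (map_inj_poly (f := intr : int -> algC)) => //; first exact: intr_inj.
(* The fields of order 2^(k+1) already provide infinitely many roots. *)
rewrite rmorph0; pose z k : algC := sqrtC (2 ^ k.+1)%:R.
apply: (@roots_geq_poly_eq0 _ _ [seq z k | k <- iota 0 (size (map_poly (intr : int -> algC) P))]).
- apply/allP=> _ /mapP[k _ ->]; have [F _ cF] := pPrimePowerField (isT : prime 2) (ltn0Sn k).
  have z0 : z k != 0 by rewrite sqrtC_eq0 pnatr_eq0 expn_eq0.
  rewrite /root evalP subr_eq0; have := pc F; rewrite cF -/(z k) /leval => <-.
  by rewrite divfK // expf_neq0.
- rewrite map_inj_uniq ?iota_uniq // => k l /(congr1 (fun x => x ^+ 2)).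
  by rewrite !sqrtCK => /eqP; rewrite eqr_nat eqn_exp2l // => /eqP [].
- by rewrite size_map size_iota.
Qed.

(** * Hall numbers over a finite field *)

Section HallNumbers.
Variables (Q : quiver) (F : finFieldType).
Implicit Types X Y Z : rep Q F.

(** A counted L is both the image of a monomorphism from Z and the kernel of an
    epimorphism onto X. *)
Lemma hallF_dim X Z Y k :
  hallF X Z Y != 0%N -> rdim Y k = (rdim X k + rdim Z k)%N.
Proof.
rewrite cards_eq0 => /set0Pn[L]; rewrite inE => /and3P[_].
move=> /existsP[f /andP[/andP[_ /forallP fM] /forallP fL]].
move=> /existsP[g /andP[/andP[_ /forallP gE] /forallP gL]].
have fg : (f k :=: kermx (g k))%MS.
  apply/eqmxP/andP; split; apply/rV_subP=> u.
    move=> /submxP[w ->]; apply/sub_kermxP/eqP.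
    have := gL k => /eqP/setP/(_ (w *m f k)); rewrite inE => <-.
    by rewrite (eqP (fL k)); apply/imsetP; exists w.
  move=> /sub_kermxP ug; have := gL k => /eqP/setP/(_ u); rewrite inE ug eqxx.
  by rewrite (eqP (fL k)) => /imsetP[w _ ->]; apply: submxMl.
have rk := mxrank_ker (g k); have rf := fM k; have rg := gE k.
rewrite -fg (eqP rf) (eqP rg) in rk.
by rewrite rk subnKC // -{1}(eqP rg) rank_leq_row.
Qed.

Definition rep_id X : rephom X X := [ffun k => 1%:M].

Lemma rep_id_is_iso X : is_iso (rep_id X).
Proof.
have hom : is_rephom (rep_id X).
  by apply/forallP=> a; rewrite !ffunE mulmx1 mul1mx.
rewrite /is_iso /is_mono /is_epi hom /=.
by apply/andP; split; apply/forallP=> k; rewrite ffunE /row_free /row_full mxrank1 eqxx.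
Qed.

(** The zero subrepresentation is the only one counted. *)
Lemma hallF_r0 Y : hallF Y (rep0 Q F) Y = 1%N.
Proof.
pose L0 : subspaces Y := [ffun k => [set 0]].
rewrite /hallF; suff -> : [set L : subspaces Y |
    [&& subrep L, sub_iso (rep0 Q F) L & quo_iso Y L]] = [set L0].
  exact: cards1.
apply/setP=> L; rewrite !inE; apply/idP/eqP => [/and3P[_ /existsP[f /andP[_ /forallP fL]] _]|->].
  apply/ffunP=> k; rewrite ffunE (eqP (fL k)); apply/setP=> u; rewrite inE.
  apply/imsetP/eqP => [[w _ ->]|->]; first by rewrite (thinmx0 w) mul0mx.
  by exists 0 => //; rewrite mul0mx.
apply/and3P; split.
- apply/andP; split; apply/forallP=> k; rewrite ?ffunE.
    rewrite set11 /=; apply/forallP=> c; apply/forall_inP=> u /set1P ->.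
    by apply/forall_inP=> w /set1P ->; rewrite scaler0 addr0 set11.
  by apply/forall_inP=> u /set1P ->; rewrite mul0mx set11.
- apply/existsP; exists [ffun k => 0]; apply/andP; split.
    apply/andP; split; first by apply/forallP=> a; rewrite !ffunE mulmx0 mul0mx.
    by apply/forallP=> k; rewrite /row_free -leqn0 rank_leq_row.
  apply/forallP=> k; rewrite !ffunE; apply/eqP/setP=> u; rewrite inE.
  apply/eqP/imsetP => [->|[w _ ->]]; last by rewrite mulmx0.
  by exists 0 => //; rewrite mul0mx.
- apply/existsP; exists (rep_id Y); have /andP[_ ->] := rep_id_is_iso Y.
  apply/forallP=> k; rewrite !ffunE; apply/eqP/setP=> u; rewrite !inE.
  by rewrite mulmx1.
Qed.

(** The full subrepresentation is the only one counted. *)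
Lemma hallF_l0 Y : hallF (rep0 Q F) Y Y = 1%N.
Proof.
pose L0 : subspaces Y := [ffun k => [set: 'rV[F]_(rdim Y k)]%SET].
rewrite /hallF; suff -> : [set L : subspaces Y |
    [&& subrep L, sub_iso Y L & quo_iso (rep0 Q F) L]] = [set L0].
  exact: cards1.
apply/setP=> L; rewrite !inE; apply/idP/eqP => [/and3P[_ _ /existsP[f /andP[_ /forallP fL]]]|->].
  apply/ffunP=> k; rewrite ffunE (eqP (fL k)); apply/setP=> u; rewrite !inE.
  by apply/eqP; exact: thinmx0.
apply/and3P; split.
- apply/andP; split; apply/forallP=> k; rewrite ?ffunE.
    rewrite inE /=; apply/forallP=> c; apply/forall_inP=> u _.
    by apply/forall_inP=> w _; rewrite inE.
  by apply/forall_inP=> u _; rewrite inE.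
- apply/existsP; exists (rep_id Y); have /andP[-> _] := rep_id_is_iso Y.
  apply/forallP=> k; rewrite !ffunE; apply/eqP/setP=> u; rewrite inE.
  by apply/esym/imsetP; exists u; rewrite ?mulmx1.
- apply/existsP; exists [ffun k => 0]; apply/andP; split.
    apply/andP; split; first by apply/forallP=> a; rewrite !ffunE mulmx0 mul0mx.
    by apply/forallP=> k; rewrite /row_full -leqn0 rank_leq_col.
  by apply/forallP=> k; rewrite !ffunE; apply/eqP/setP=> u; rewrite !inE mulmx0 eqxx.
Qed.

Lemma autnum_rep0 : autnum (rep0 Q F) = 1%N.
Proof.
rewrite /autnum; suff -> : [set f : rephom (rep0 Q F) (rep0 Q F) | is_iso f]
    = [set rep_id (rep0 Q F)].
  exact: cards1.
apply/setP=> f; rewrite !inE; have -> : f = rep_id (rep0 Q F).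
  by apply/ffunP=> k; rewrite [LHS]flatmx0 [RHS]flatmx0.
by rewrite rep_id_is_iso eqxx.
Qed.

End HallNumbers.

(** * Multiplicity functions of small dimension *)

Section DimensionVectors.
Variables (Q : quiver) (D : hall_data Q).
Implicit Types l m n : kostant Q.

Lemma dimvecE l k : dimvec l k = \sum_(b <- finsupp l) val b k *+ l b.
Proof.
rewrite /dimvec (big_morph (fun x : lattice Q => x k) (id1 := 0) (op1 := +%R)).
- by apply: eq_bigr => b _; rewrite ffunMnE.
- by move=> x y; rewrite ffunE.
- by rewrite ffunE.
Qed.

Lemma rep_of_kostant0 (F : finFieldType) (M : proot Q -> rep Q F) :
  rep_of M (kostant0 Q) = rep0 Q F.
Proof. by rewrite /rep_of /kostant0 finsupp0. Qed.

Lemma rdim_rep_of (F : finFieldType) l k :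
  (rdim (rep_of (hallM D F) l) k)%:Z = dimvec l k.
Proof.
rewrite dimvecE /rep_of; elim: (finsupp l : seq _) => [|b s IH].
  by rewrite big_nil.
rewrite big_cons -{}IH /=; elim: (l b) => [|n IH]; first by rewrite mulr0n add0r.
by rewrite /= PoszD IH hallM_dim addrA -mulrS.
Qed.

Lemma posroot_ge0 (b : proot Q) k : 0 <= val b k.
Proof. by have /asboolP[_] := valP b. Qed.

Lemma dimvec_ge0 l k : 0 <= dimvec l k.
Proof. by rewrite dimvecE sumr_ge0 // => b _; rewrite mulrn_wge0 ?posroot_ge0. Qed.

Lemma dimvec_kostant0 : dimvec (kostant0 Q) = 0.
Proof. by rewrite /dimvec /kostant0 finsupp0 big_nil. Qed.

Lemma finsupp_kostant1 (b : proot Q) : finsupp (kostant1 b) = [fset b]%fset.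
Proof. by apply/fsetP=> c; rewrite mem_finsupp fsfunE !inE; case: (c == b). Qed.

Lemma dimvec_kostant1 (b : proot Q) : dimvec (kostant1 b) = val b.
Proof. by rewrite /dimvec finsupp_kostant1 big_seq_fset1 fsfunE inE eqxx. Qed.

(** The sum of the coordinates; being additive and positive on positive roots, it bounds
    the number of summands of a representation. *)
Definition height (x : lattice Q) : int := \sum_k x k.

Lemma height_dimvec l : height (dimvec l) = \sum_(b <- finsupp l) height (val b) *+ l b.
Proof.
rewrite /height; under eq_bigr do rewrite dimvecE.
by rewrite exchange_big; apply: eq_bigr => b _; rewrite /= sumrMnl.
Qed.

(** A positive root is nonzero because it is the dimension vector of an indecomposable
    representation over some field, here the one with two elements. *)
Lemma height_posroot_gt0 (b : proot Q) : 0 < height (val b).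
Proof.
rewrite lt_def sumr_ge0 ?andbT => [|k _]; last exact: posroot_ge0.
have [/negP nz _] := hallM_indec D 'F_2 b; apply/eqP => h0; apply: nz.
apply/forallP=> k; rewrite -(eqr_nat int) natz hallM_dim.
by apply/eqP/(psumr_eq0P _ h0) => // j _; exact: posroot_ge0.
Qed.

(** A summand would contribute a positive height. *)
Lemma dimvec_eq0 l : dimvec l = 0 -> l = kostant0 Q.
Proof.
move=> l0; apply/fsfunP=> b; rewrite fsfunE; apply/eqP/negPn/negP=> lb.
have bl : b \in finsupp l by rewrite mem_finsupp.
have := height_dimvec l; rewrite l0 (big_fsetD1 b) //=.
rewrite {1}/height big1 => [|k _]; last by rewrite ffunE.
apply/eqP; rewrite lt_eqF // ltr_pwDl ?sumr_ge0 // => [|c _].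
  by rewrite pmulrn_lgt0 ?height_posroot_gt0 // lt0n.
by rewrite mulrn_wge0 // ltW ?height_posroot_gt0.
Qed.

Lemma height_simple i : height (simple_root i) = 1 :> int.
Proof.
rewrite /height (bigD1 i) //= ffunE eqxx big1 ?addr0 // => j ji.
by rewrite ffunE eq_sym (negbTE ji).
Qed.

(** Since a simple root has height 1, there is exactly one summand, and its root is read
    off the dimension vector. *)
Lemma dimvec_eq_simple l i : dimvec l = simple_root i -> l = kostant_simple i.
Proof.
move=> li; have [l0|[b bl]] := fset_0Vmem (finsupp l).
  have := height_simple i; rewrite -li height_dimvec l0 big_seq_fset0 => /eqP.
  by rewrite eq_sym oner_eq0.
pose n c := height (val c) *+ l c.
have n_gt0 c : c \in finsupp l -> 0 < n c.
  by rewrite mem_finsupp -lt0n => lc; rewrite pmulrn_lgt0 ?height_posroot_gt0.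
have := height_simple i; rewrite -li height_dimvec (big_fsetD1 b) //= -/(n b) => h1.
have nb : 1 <= n b by rewrite -gtz0_ge1 n_gt0.
have rest_ge0 (A : {fset proot Q}) : 0 <= \sum_(c <- A) n c.
  by apply: sumr_ge0 => c _; rewrite mulrn_wge0 // ltW ?height_posroot_gt0.
have supp_b : finsupp l = [fset b]%fset.
  apply/fsetP=> c; rewrite inE; apply/idP/eqP => [cl|->//]; apply/eqP/negPn/negP=> cb.
  have cD : c \in (finsupp l `\ b)%fset by rewrite !inE cb.
  have := h1; rewrite (big_fsetD1 c) //= -/(n c) => /eqP; rewrite gt_eqF //.
  have nc : 1 <= n c by rewrite -gtz0_ge1 n_gt0.
  by rewrite (lt_le_trans (y := 1 + 1)) // lerD // ler_wpDr.
have lb1 : l b = 1%N.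
  have lb : l b != 0%N by rewrite -mem_finsupp.
  move: h1; rewrite supp_b fsetDv big_seq_fset0 addr0 /n => h1.
  have hb : 1 <= height (val b) by rewrite -gtz0_ge1 height_posroot_gt0.
  have le_lb : (l b)%:R <= height (val b) *+ l b by rewrite -[X in _ <= X]mulr_natr ler_peMl.
  by apply/eqP; rewrite eqn_leq lt0n lb andbT -(ler_nat int) (le_trans le_lb) ?h1.
have -> : l = kostant1 b.
  apply/fsfunP=> c; rewrite fsfunE inE; case: eqP => [->//|/eqP cb].
  by rewrite fsfun_dflt // supp_b inE.
rewrite /kostant_simple; congr kostant1; apply: val_inj.
by rewrite /= -li /dimvec supp_b big_seq_fset1 lb1.
Qed.

(** Nonnegative vectors adding up to a simple root are 0 and that root, which determine
    the multiplicity functions. *)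
Lemma dimvecD_eq_simple l m i : dimvec l + dimvec m = simple_root i ->
  (l = kostant_simple i /\ m = kostant0 Q) \/ (l = kostant0 Q /\ m = kostant_simple i).
Proof.
move=> lm; have lmk k : dimvec l k + dimvec m k = (i == k)%:R.
  by have := congr1 (fun x : lattice Q => x k) lm; rewrite !ffunE.
have zero x k : k != i -> (x = l \/ x = m) -> dimvec x k = 0.
  move=> ki xlm; have /eqP := lmk k; rewrite [i == k]eq_sym (negbTE ki) paddr_eq0 ?dimvec_ge0 //.
  by move=> /andP[/eqP lk /eqP mk]; case: xlm => ->.
have [l0|lN0] := eqVneq (dimvec l i) 0.
  have l00 : l = kostant0 Q.
    apply: dimvec_eq0; apply/ffunP=> k; rewrite !ffunE.
    by have [->//|ki] := eqVneq k i; rewrite zero //; left.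
  by right; split => //; apply: dimvec_eq_simple; rewrite -lm l00 dimvec_kostant0 add0r.
have m0 : m = kostant0 Q.
  apply: dimvec_eq0; apply/ffunP=> k; rewrite !ffunE.
  have [->|ki] := eqVneq k i; last by rewrite zero //; right.
  have l1 : 1 <= dimvec l i by rewrite -gtz0_ge1 lt_def lN0 dimvec_ge0.
  have := lmk i; rewrite eqxx => e; apply/le_anti; rewrite dimvec_ge0 andbT.
  by rewrite -(lerD2l (dimvec l i)) e addr0.
by left; split => //; apply: dimvec_eq_simple; rewrite -lm m0 dimvec_kostant0 addr0.
Qed.

Lemma dimvecD3_eq0 l m n : dimvec l + dimvec m + dimvec n = 0 ->
  [/\ l = kostant0 Q, m = kostant0 Q & n = kostant0 Q].
Proof.
move=> lmn; have lmnk k : [&& dimvec l k == 0, dimvec m k == 0 & dimvec n k == 0].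
  rewrite andbA -!paddr_eq0 ?addr_ge0 ?dimvec_ge0 //.
  by have := congr1 (fun x : lattice Q => x k) lmn; rewrite !ffunE => ->.
by split; apply: dimvec_eq0; apply/ffunP=> k; have /and3P[/eqP lk /eqP mk /eqP nk] := lmnk k;
  rewrite ffunE.
Qed.

End DimensionVectors.

(** * Sums with one or two nonzero terms *)

Lemma fsbig_single (T : choiceType) (V : nmodType) (f : T -> V) x :
  (forall y, y != x -> f y = 0) -> \sum_(y \in [set: T]%classic) f y = f x.
Proof.
move=> fx; rewrite (fsbigTE [fset x]%fset) ?big_seq_fset1 // => y.
by rewrite inE; exact: fx.
Qed.

Lemma fsbig_two (T : choiceType) (V : nmodType) (f : T -> V) x y : x != y ->
  (forall z, z != x -> z != y -> f z = 0) ->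
  \sum_(z \in [set: T]%classic) f z = f x + f y.
Proof.
move=> xy fz; rewrite (fsbigTE [fset x; y]%fset) => [|z].
  by rewrite big_fsetU1 ?big_seq_fset1 // inE.
by rewrite !inE => /norP[zx zy]; exact: fz.
Qed.

(** * Values of the Hall polynomials *)

Section HallPolynomialValues.
Variables (Q : quiver) (D : hall_data Q).
Implicit Types l m n : kostant Q.
Local Notation o := (kostant0 Q).

(** If the dimensions do not match, the Hall number vanishes over every finite field. *)
Lemma fpol_dimvec l m n : fpol D l m n != 0 -> dimvec n = dimvec l + dimvec m.
Proof.
apply: contra_neq_eq => dn; apply: (leval_constant (c := 0)) => F; rewrite hfE.
congr _%:R; apply/eqP/negPn/negP => /hallF_dim dF.
case/eqP: dn; apply/ffunP=> k; rewrite ffunE -!(rdim_rep_of D F).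
by rewrite -PoszD -dF.
Qed.

Lemma fpol_r0 l : fpol D l o l = 1.
Proof.
by apply: (leval_constant (c := 1)) => F; rewrite hfE rep_of_kostant0 hallF_r0.
Qed.

Lemma fpol_l0 l : fpol D o l l = 1.
Proof.
by apply: (leval_constant (c := 1)) => F; rewrite hfE rep_of_kostant0 hallF_l0.
Qed.

Lemma apol_0 : apol D o = 1.
Proof.
by apply: (leval_constant (c := 1)) => F; rewrite haE rep_of_kostant0 autnum_rep0.
Qed.

Lemma fpol3_dimvec l1 l2 l3 l :
  fpol3 D l1 l2 l3 l != 0 -> dimvec l = dimvec l1 + dimvec l2 + dimvec l3.
Proof.
apply: contra_neq_eq => dl; apply: fsbig1 => m _; apply/eqP; rewrite mulf_eq0.
apply/norP => -[/fpol_dimvec d1 /fpol_dimvec d2]; case/eqP: dl.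
by rewrite d1 d2 addrA.
Qed.

Lemma fpol3_l l : fpol3 D l o o l = 1.
Proof.
rewrite /fpol3 (fsbig_single (x := o)) ?fpol_r0 ?mulr1 // => m mo.
apply/eqP; rewrite mulf_eq0; apply/norP => -[/fpol_dimvec + _].
by rewrite -[LHS]addr0 => /addrI/esym/(dimvec_eq0 D)/eqP; apply/negP.
Qed.

(** The middle index of the sum has dimension vector alpha_i, hence is the simple root;
    for a general multiplicity function the Krull-Schmidt theorem would be needed here. *)
Lemma fpol3_r_simple i : fpol3 D o o (kostant_simple i) (kostant_simple i) = 1.
Proof.
rewrite /fpol3 (fsbig_single (x := kostant_simple i)) ?fpol_l0 ?mulr1 // => m mi.
apply/eqP; rewrite mulf_eq0; apply/norP => -[/fpol_dimvec + _].
rewrite dimvec_kostant0 add0r dimvec_kostant1 => /esym/(dimvec_eq_simple D)/eqP.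
exact/negP.
Qed.

End HallPolynomialValues.

(** * The coproduct on simple modules *)

Section Coproduct.
Variables (Q : quiver) (D : hall_data Q) (Ddbl : hall_data (dbl Q)).
Variables (H : algType Kv) (KK : lattice (dbl Q) -> H) (uu : kostant (dbl Q) -> H).
Hypothesis H_spec : is_ihall (swap Q) Ddbl KK uu.
Variable hopfH : hopf H.
Hypothesis hopfH_spec : is_dbl_hopf D KK uu hopfH.
Local Notation o := (kostant0 Q).
Local Notation s := (@kostant_simple Q).

Lemma dblu00 : dblu uu o o = 1.
Proof.
rewrite -(ihall_u0 H_spec); congr uu; apply/fsfunP=> b.
rewrite !fsfunE big_seq_cond [X in (_ + X)%N]big_seq_cond.
by rewrite !big1 ?if_same // => c /andP[]; rewrite finsupp0 inE.
Qed.

Lemma dblK0 : dblK KK 0 = 1.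
Proof. by rewrite /dblK raddf0 (ihall_K0 H_spec). Qed.

Lemma dblKd0 : dblKd KK 0 = 1.
Proof. by rewrite /dblKd raddf0 (ihall_K0 H_spec). Qed.

Lemma dbl_coef_dimvec l m l1 l2 m1 m2 nu : dbl_coef D l m l1 l2 m1 m2 nu != 0 ->
  dimvec l = dimvec l1 + dimvec nu + dimvec l2 /\
  dimvec m = dimvec m1 + dimvec nu + dimvec m2.
Proof.
rewrite /dbl_coef mulf_eq0 => /norP[+ /fpol3_dimvec ->].
by rewrite mulf_eq0 => /norP[_ /fpol3_dimvec ->].
Qed.

Lemma euler0l x : euler (0 : lattice Q) x = 0.
Proof. by rewrite /euler !big1 ?subr0 // => k _; rewrite ffunE mul0r. Qed.

Lemma euler0r x : euler x (0 : lattice Q) = 0.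
Proof. by rewrite /euler !big1 ?subr0 // => k _; rewrite ffunE mulr0. Qed.

Lemma simple_neq0 i : s i != o.
Proof.
apply/eqP => /(congr1 (@dimvec Q)); rewrite dimvec_kostant0 dimvec_kostant1.
by move=> /(congr1 (fun x : lattice Q => x i)); rewrite !ffunE eqxx.
Qed.

(** As the second index is 0, so are [m1], [m2] and [nu]; what remains of the simple root
    goes entirely to [l1] or to [l2]. *)
Lemma comul_dblu_simplel i : comul hopfH (dblu uu (s i) o) =
  tpure (dblu uu (s i) o) 1 + tpure (dblKd KK (simple_root i)) (dblu uu (s i) o).
Proof.
rewrite (dbl_comulu hopfH_spec) (@fsbig_two _ _ _ (s i, o, o, o, o) (o, s i, o, o, o)).
- rewrite /dbl_coef !dimvec_kostant0 dimvec_kostant1 /= /eulers.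
  rewrite !(addr0, add0r) !(euler0l, euler0r) !(fpol3_l, fpol3_r_simple) apol_0.
  rewrite !(addr0, subr0) expr0z !mulr1 !scale1r dblu00 dblK0 dblKd0.
  by rewrite !(mulr1, mul1r).
- by apply/eqP => -[/eqP]; rewrite (negbTE (simple_neq0 i)).
move=> [[[[l1 l2] m1] m2] nu] n1 n2.
have [->|/dbl_coef_dimvec[dl dm]] := eqVneq (dbl_coef D (s i) o l1 l2 m1 m2 nu) 0.
  by rewrite scale0r.
move: dm n1 n2 dl; rewrite dimvec_kostant0 => /esym/(dimvecD3_eq0 D)[-> -> ->] n1 n2.
rewrite dimvec_kostant0 addr0 dimvec_kostant1 => /esym/(dimvecD_eq_simple D).
by case=> -[e1 e2]; [move: n1 | move: n2]; rewrite e1 e2 eqxx.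
Qed.

(** The mirror image: here [l1], [l2] and [nu] vanish, and the simple root goes to [m1] or
    to [m2]. *)
Lemma comul_dblu_simpler i : comul hopfH (dblu uu o (s i)) =
  tpure 1 (dblu uu o (s i)) + tpure (dblu uu o (s i)) (dblK KK (simple_root i)).
Proof.
rewrite (dbl_comulu hopfH_spec) (@fsbig_two _ _ _ (o, o, s i, o, o) (o, o, o, s i, o)).
- rewrite /dbl_coef !dimvec_kostant0 dimvec_kostant1 /= /eulers.
  rewrite !(addr0, add0r) !(euler0l, euler0r) !(fpol3_l, fpol3_r_simple) apol_0.
  rewrite !(addr0, subr0) expr0z !mulr1 !scale1r dblu00 dblK0 dblKd0.
  by rewrite !(mulr1, mul1r).
- by apply/eqP => -[/eqP]; rewrite (negbTE (simple_neq0 i)).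
move=> [[[[l1 l2] m1] m2] nu] n1 n2.
have [->|/dbl_coef_dimvec[dl dm]] := eqVneq (dbl_coef D o (s i) l1 l2 m1 m2 nu) 0.
  by rewrite scale0r.
move: dl n1 n2 dm; rewrite dimvec_kostant0 => /esym/(dimvecD3_eq0 D)[-> -> ->] n1 n2.
rewrite dimvec_kostant0 addr0 dimvec_kostant1 => /esym/(dimvecD_eq_simple D).
by case=> -[e1 e2]; [move: n1 | move: n2]; rewrite e1 e2 eqxx.
Qed.

End Coproduct.

(** * The isomorphism of Hopf algebras *)

Theorem corollary4p6 (Q : quiver) (Q_dynkin : is_dynkin Q)
    (D : hall_data Q) (Ddbl : hall_data (dbl Q))
    (hopfU : hopf (Utilde Q)) (hopfU_spec : is_Utilde_hopf hopfU)
    (H : algType Kv) (KK : lattice (dbl Q) -> H) (uu : kostant (dbl Q) -> H)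
    (H_spec : is_ihall (swap Q) Ddbl KK uu)
    (hopfH : hopf H) (hopfH_spec : is_dbl_hopf D KK uu hopfH)
    (psi : {lrmorphism Utilde Q -> H}) (psi_bij : bijective psi)
    (psiE : forall i, psi (ug (genE i)) =
       vh^-1 *: dblu uu (kostant_simple i) (kostant0 Q))
    (psiF : forall i, psi (ug (genF i)) =
       vh^-1 *: dblu uu (kostant0 Q) (kostant_simple i))
    (psiK : forall i, psi (ug (genK i)) = dblKd KK (simple_root i))
    (psiK' : forall i, psi (ug (genK' i)) = dblK KK (simple_root i)) :
  hopf_iso hopfU hopfH psi.
Proof.
have psi_lin := tmap_linear psi psi.
have TD := linear_propD psi_lin.
have TP a b : tmap psi psi (tpure a b) = tpure (psi a) (psi b).
  exact: tmap_pure.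
have tZl (c : Kv) (a b : H) : tpure (c *: a) b = c *: tpure a b :> tens H H.
  exact: linear_propZ ((tpure_bilin H H).1 b).
have tZr (c : Kv) (a b : H) : tpure a (c *: b) = c *: tpure a b :> tens H H.
  exact: linear_propZ ((tpure_bilin H H).2 a).
have DZ c x : comul hopfH (c *: x) = c *: comul hopfH x.
  exact: linear_propZ (comul_linear hopfH).
apply: bialgebra_iso_hopf_iso => //.
apply: (Utilde_morphism_ext (f := fun x => comul hopfH (psi x))
  (g := fun x => tmap psi psi (comul hopfU x))).
- split=> [|x y]; first by rewrite rmorph1 (comul_morph hopfH).1.
  by rewrite rmorphM (comul_morph hopfH).2.
- have [t1 tM] := tmap_monoid_morphism psi.
  split=> [|x y]; first by rewrite (comul_morph hopfU).1.
  by rewrite (comul_morph hopfU).2.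
- move=> c x y ex ey; rewrite linearP (comul_linear hopfH) ex ey.
  by rewrite (comul_linear hopfU) psi_lin.
- move=> i; transitivity (tpure (psi (ug (genE i))) (psi 1)
      + tpure (psi (ug (genK i))) (psi (ug (genE i))) : tens H H); last first.
    have e := congr1 (tmap psi psi) (comulE hopfU_spec i).
    by apply/esym/(etrans e)/(etrans (TD _ _)); congr (_ + _); exact: TP.
  rewrite rmorph1 psiE psiK DZ (comul_dblu_simplel H_spec hopfH_spec).
  by rewrite tZl tZr -scalerDr.
- move=> i; transitivity (tpure (psi 1) (psi (ug (genF i)))
      + tpure (psi (ug (genF i))) (psi (ug (genK' i))) : tens H H); last first.
    have e := congr1 (tmap psi psi) (comulF hopfU_spec i).
    by apply/esym/(etrans e)/(etrans (TD _ _)); congr (_ + _); exact: TP.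
  rewrite rmorph1 psiF psiK' DZ (comul_dblu_simpler H_spec hopfH_spec).
  by rewrite tZl tZr -scalerDr.
- move=> i; apply: etrans (_ : tpure (psi (ug (genK i))) (psi (ug (genK i))) = _).
    by rewrite psiK; exact: (dbl_comulKd hopfH_spec).
  exact/esym/(etrans (congr1 (tmap psi psi) (comulK hopfU_spec i)))/TP.
- move=> i; apply: etrans (_ : tpure (psi (ug (genK' i))) (psi (ug (genK' i))) = _).
    by rewrite psiK'; exact: (dbl_comulK hopfH_spec).
  exact/esym/(etrans (congr1 (tmap psi psi) (comulK' hopfU_spec i)))/TP.
Qed.
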